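(* For ${\rm APP}=\{{\rm APP}_d\}_{d\in\mathbb N}$ in the average case setting with the absolute error criterion, ${\rm APP}$ is EXP-UWT for $\Lambda^{\rm all}$ iff it is EXP-UWT for $\Lambda^{\rm std}$.
   Context: Setting (average case approximation). For each $d\in\mathbb N$: $D_d\subset\mathbb R^d$ is a Borel set of positive Lebesgue measure, $\rho_d$ is a probability density on $D_d$, and $G_d=L_2(D_d,\rho_d(x)\,dx)$. $F_d$ is a separable Banach space of real-valued functions on $D_d$, continuously embedded in $G_d$, such that every point evaluation $f\mapsto f(x)$, $x\in D_d$, is a continuous linear functional on $F_d$; $F_d$ carries a zero-mean Gaussian measure $\mu_d$. ${\rm APP}_d:F_d\to G_d$, ${\rm APP}_d f=f$. $\Lambda^{\rm all}$ is the class of all continuous linear functionals on $F_d$, $\Lambda^{\rm std}$ the class of point evaluations. For $\Lambda\in\{\Lambda^{\rm all},\Lambda^{\rm std}\}$, an algorithm is $A_{n,d}f=\phi_{n,d}(L_1(f),\dots,L_n(f))$ with $L_i\in\Lambda$ and $\phi_{n,d}:\mathbb R^n\to G_d$ measurable; its average case error is $e^{\rm avg}(A_{n,d})=\big(\int_{F_d}\|f-A_{n,d}f\|_{G_d}^2\,\mu_d(df)\big)^{1/2}$, and $e^{\rm avg}(n,d;\Lambda)$ is the infimum of $e^{\rm avg}(A_{n,d})$ over all such algorithms using $n$ functionals from $\Lambda$ (for $n=0$, $A_{0,d}=0$). Absolute-error information complexity: $n^{\rm ABS}(\varepsilon,d;\Lambda)=\min\{n\ge0:\ e^{\rm avg}(n,d;\Lambda)\le\varepsilon\}$.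 EXP-UWT for $\Lambda$: for all $\alpha,\beta>0$, $\lim_{\varepsilon^{-1}+d\to\infty}\frac{\ln n^{\rm ABS}(\varepsilon,d;\Lambda)}{(1+\ln\varepsilon^{-1})^{\alpha}+d^{\beta}}=0$, where the limit means: for every $\eta>0$ there is $M$ such that the quotient is $<\eta$ for all $d\in\mathbb N$, $\varepsilon\in(0,1)$ with $\varepsilon^{-1}+d>M$. *)

(* Defs.v *)
From HB Require Import structures.
From mathcomp Require Import all_boot all_order all_algebra.
From mathcomp Require Import all_classical all_reals all_analysis.
Set Implicit Arguments. Unset Strict Implicit. Unset Printing Implicit Defensive.
Import Order.TTheory GRing.Theory Num.Theory.
Import numFieldNormedType.Exports.
Local Open Scope classical_set_scope.
Local Open Scope ring_scope.

(* Points of R^d are d-tuples of reals, with the product (= Borel) sigma-algebra. *)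

(* d-dimensional Lebesgue measure on R^d = d.-tuple R, given on measurable sets
   by iterated one-dimensional Lebesgue integrals (Tonelli). *)
Fixpoint leb_tuple (R : realType) (n : nat) : set (n.-tuple R) -> \bar R :=
  match n return set (n.-tuple R) -> \bar R with
  | 0 => fun A => ((\1_A [tuple]) : R)%:E
  | n'.+1 => fun A =>
      (\int[@lebesgue_measure R]_x @leb_tuple R n' [set t | A (cons_tuple (x : R) t)])%E
  end.

Notation borel V := (g_sigma_algebraType (@open V)).

Definition L2norm2 (R : realType) (d : nat) (D : set (d.-tuple R))
  (rho : d.-tuple R -> R) (g : d.-tuple R -> R) : \bar R :=
  (\int[@leb_tuple R d]_(x in D) ((g x ^+ 2) * rho x)%:E)%E.

Definition centered_gaussian (R : realType) (V : normedModType R)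
  (mu : set (borel V) -> \bar R) : Prop :=
  forall L : V -> R,
    (forall (a : R) (u v : V), L (a *: u + v) = a * L u + L v) ->
    continuous L ->
    (forall B : set R, measurable B -> mu (L @^-1` B) = \d_(0 : R) B) \/
    (exists s : R, 0 < s /\
       forall B : set R, measurable B -> mu (L @^-1` B) = normal_prob 0 s B).

Definition avg_setting (R : realType) (d : nat) (D : set (d.-tuple R))
  (rho : d.-tuple R -> R) (F : completeNormedModType R)
  (ev : F -> d.-tuple R -> R) (mu : probability (borel F) R) : Prop :=
  [/\
      measurable D /\ (0 < leb_tuple D)%E,
      [/\ measurable_fun D rho, (forall x, D x -> 0 <= rho x) &
          (\int[@leb_tuple R d]_(x in D) (rho x)%:E)%E = 1%E],
      (* F is a separable Banach space of functions on D (ev f is the function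
         represented by f; vector operations are pointwise on D) *)
      [/\ (exists s : nat -> F, dense (range s)),
          (forall (a : R) (f g : F) x, D x -> ev (a *: f + g) x = a * ev f x + ev g x) &
          (forall f g : F, (forall x, D x -> ev f x = ev g x) -> f = g)],
      (* F is continuously embedded in G = L_2(D, rho(x) dx) *)
      [/\ (forall f : F, measurable_fun D (ev f)),
          (forall f : F, L2norm2 D rho (ev f) = 0%E -> f = 0)
          & (exists C : R, forall f : F,
            (L2norm2 D rho (ev f) <= ((C * `|f|) ^+ 2)%:E)%E)] &
      (forall x, D x -> continuous (fun f : F => ev f x)) /\ centered_gaussian mu].

Inductive info_class := Lall | Lstd.

Definition admissible (R : realType) (d : nat) (D : set (d.-tuple R))
  (F : normedModType R) (ev : F -> d.-tuple R -> R) (Lam : info_class)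
  (n : nat) (L : 'I_n -> F -> R) : Prop :=
  match Lam with
  | Lall => forall i, (forall (a : R) (u v : F), L i (a *: u + v) = a * L i u + L i v)
                      /\ continuous (L i)
  | Lstd => exists x : 'I_n -> d.-tuple R, forall i, D (x i) /\ L i = (fun f => ev f (x i))
  end.

(* Admissible maps phi : R^n -> G_d (given through representatives; measurable
   as a map of (y, x), with values in L_2). *)
Definition admissible_phi (R : realType) (d : nat) (D : set (d.-tuple R))
  (rho : d.-tuple R -> R) (n : nat) (phi : n.-tuple R -> d.-tuple R -> R) : Prop :=
  measurable_fun setT (fun p : n.-tuple R * d.-tuple R => phi p.1 p.2) /\
  forall y, (L2norm2 D rho (phi y) < +oo)%E.

Definition avg_err (R : realType) (d : nat) (D : set (d.-tuple R))
  (rho : d.-tuple R -> R) (F : normedModType R) (ev : F -> d.-tuple R -> R)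
  (mu : probability (borel F) R) (n : nat) (L : 'I_n -> F -> R)
  (phi : n.-tuple R -> d.-tuple R -> R) : \bar R :=
  ((\int[mu]_f L2norm2 D rho (fun x => (ev f x - phi [tuple L i f | i < n] x)%R))
     `^ (2^-1 : R))%E.

(* n-th minimal average case error e^avg(n, d; Lam); for n = 0, A = 0. *)
Definition nth_min_err (R : realType) (d : nat) (D : set (d.-tuple R))
  (rho : d.-tuple R -> R) (F : normedModType R) (ev : F -> d.-tuple R -> R)
  (mu : probability (borel F) R) (Lam : info_class) (n : nat) : \bar R :=
  if n is 0 then
    ((\int[mu]_f L2norm2 D rho (ev f)) `^ (2^-1 : R))%E
  else
    ereal_inf [set e | exists (L : 'I_n -> F -> R) (phi : n.-tuple R -> d.-tuple R -> R),
                 [/\ admissible D ev Lam L, admissible_phi D rho phi &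
                     e = avg_err D rho ev mu L phi]].

(* Absolute-error information complexity (as an extended real: +oo if no n works). *)
Definition nABS (R : realType) (d : nat) (D : set (d.-tuple R))
  (rho : d.-tuple R -> R) (F : normedModType R) (ev : F -> d.-tuple R -> R)
  (mu : probability (borel F) R) (Lam : info_class) (eps : R) : \bar R :=
  ereal_inf [set (n%:R)%:E | n in [set n : nat | (nth_min_err D rho ev mu Lam n <= eps%:E)%E]].

(* EXP-UWT for a family indexed by d in N = {1, 2, ...} (the d = 0 components are irrelevant). *)
Definition EXP_UWT (R : realType) (D : forall d : nat, set (d.-tuple R))
  (rho : forall d : nat, d.-tuple R -> R) (F : nat -> completeNormedModType R)
  (ev : forall d : nat, F d -> d.-tuple R -> R)
  (mu : forall d : nat, probability (borel (F d)) R) (Lam : info_class) : Prop :=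
  forall alpha beta : R, 0 < alpha -> 0 < beta ->
  forall eta : R, 0 < eta -> exists M : R,
  forall (d : nat) (eps : R), (0 < d)%N -> 0 < eps < 1 -> M < eps^-1 + d%:R ->
    (nABS (D d) (rho d) (ev d) (mu d) Lam eps < +oo)%E /\
    ln (fine (nABS (D d) (rho d) (ev d) (mu d) Lam eps))
      / ((1 + ln eps^-1) `^ alpha + d%:R `^ beta) < eta.

(* Main.v *)
(* Point evaluations are continuous linear functionals, which gives one direction.
   For the other one, fix an algorithm using n arbitrary functionals with squared
   error C.

   Conditioning a Gaussian process on finitely many functionals amounts to linear
   regression, so the optimal algorithm for given functionals is linear and takes
   values in the span of n functions c_j(x) = E[f(x) Y_j].  Let eta be an
   orthonormal basis, in L_2, of the square-integrable part of that span; the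
   expected squared L_2 distance from f to the span of eta is then at most C.

   If the residual is orthogonal to the k functions eta_j, a point z drawn with
   density (1/k) sum_j eta_j(z)^2 can be interpolated by an element of their span
   so that the expected squared residual grows by a factor 1 + 1/k only, while the
   functions left to be matched are the k - 1 ones vanishing at z.  These factors
   telescope: n points reach squared error (n + 1) C.  The polynomial loss n + 1
   is harmless, because EXP-UWT bounds n itself: running the argument at accuracy
   eps^2 exp(- d^beta - 4) absorbs it.  *)

Require Import Defs.
From HB Require Import structures.
From mathcomp Require Import all_boot all_order all_algebra.
From mathcomp Require Import all_classical all_reals all_analysis measurable_realfun.
From mathcomp Require Import ring lra.
Set Implicit Arguments.
Unset Strict Implicit.
Unset Printing Implicit Defensive.

Import Order.TTheory GRing.Theory Num.Theory.
Import numFieldNormedType.Exports.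
Local Open Scope classical_set_scope.
Local Open Scope ring_scope.

(** * Lebesgue measure on tuples is sigma-finite *)

(** The Gaussian hypothesis speaks of one functional at a time, whereas optimality of linear
    regression concerns the joint law of the value at [x] and the data. The bridge is a symmetry:
    the regression residual [Z] is uncorrelated with the data, so every linear combination of [Z]
    and the data keeps its variance, hence its law, when [Z] is replaced by [-Z]. By Cramer-Wold the
    joint laws agree, and no measurable function of the data can reduce the second moment of [Z].
    Two obstacles shape the rest. The functions [c j] are not known to lie in L_2, only those
    combinations of them that arise from paths with square-integrable residual; hence bases are
    extracted from the square-integrable members of a span. And functions keep their point values
    instead of being taken modulo null sets, because they are sampled: orthonormal expansions hold
    up to norm zero only, whereas the interpolation identities hold at every point. *)

Definition sigma_finite_alias {d} {T : measurableType d} {R : realType}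
  (m : {measure set T -> \bar R}) (_ : sigma_finite setT m) : set T -> \bar R := m.

(** The proof [h] is an argument of the alias, so that a measure whose sigma-finiteness is known
    only through a proof term can carry the sigma-finite structure. *)
HB.instance Definition _ {d} {T : measurableType d} {R : realType}
  (m : {measure set T -> \bar R}) (h : sigma_finite setT m) :=
  isMeasure.Build d T R (sigma_finite_alias h) (measure0 m) (measure_ge0 m)
    (@measure_semi_sigma_additive _ _ _ m).

HB.instance Definition _ {d} {T : measurableType d} {R : realType}
  (m : {measure set T -> \bar R}) (h : sigma_finite setT m) :=
  Measure_isSigmaFinite.Build d T R (sigma_finite_alias h) h.

(** [leb_tuple] is a bare set function; by induction it is the image of a product measure under
    [cons]. Head and tail invert [cons], which carries the exhausting rectangles over to tuples. *)
Lemma leb_tuple_measure (R : realType) (n : nat) :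
  exists m : {sigma_finite_measure set (n.-tuple R) -> \bar R},
    (m : set _ -> \bar R) = @leb_tuple R n.
Proof.
elim: n => [|n [m mE]].
  exists (\d_([tuple] : 0.-tuple R)).
  by apply/funext => A.
pose c (p : measurableTypeR R * n.-tuple R) : n.+1.-tuple R := cons_tuple p.1 p.2.
have mc : measurable_fun setT c.
  apply: (@measurable_cons _ _ (measurableTypeR R * n.-tuple R)%type (measurableTypeR R) fst n snd) => //.
pose m1 : {sigma_finite_measure set (measurableTypeR R) -> \bar R} := @lebesgue_measure R.
pose pm : {measure set (measurableTypeR R * n.-tuple R)%type -> \bar R} := product_measure1 m1 m.
pose P0 : {measure set (n.+1.-tuple R) -> \bar R} := pushforward pm c.
pose P := P0 mc.
have h : sigma_finite setT P.
  have /sigma_finiteP[F [TF ndF Foo]] := sigma_finiteT m1.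
  have /sigma_finiteP[G [TG ndG Goo]] := sigma_finiteT m.
  pose u (t : n.+1.-tuple R) : measurableTypeR R * n.-tuple R := (thead t, [tuple of behead t]).
  have mu_ : measurable_fun setT u.
    apply: measurable_fun_pair; last exact: measurable_behead.
    exact: measurable_tnth.
  exists (fun k => u @^-1` (F k `*` G k)).
    apply/esym; rewrite -subTset => t _.
    have [k1 _ k1t] : (\bigcup_k F k) (thead t) by rewrite -TF.
    have [k2 _ k2t] : (\bigcup_k G k) [tuple of behead t] by rewrite -TG.
    exists (maxn k1 k2) => //; split => /=.
      by move: k1t; exact/subsetPset/ndF/leq_maxl.
    by move: k2t; exact/subsetPset/ndG/leq_maxr.
  move=> k; have [mF Fy] := Foo k; have [mG Gy] := Goo k; split.
    by rewrite -[X in measurable X]setTI; apply: mu_ => //; exact: measurableX.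
  rewrite /P/P0/= /pushforward.
  rewrite (_ : _ @^-1` _ = F k `*` G k).
    by rewrite /pm/= product_measure1E// lte_mul_pinfty// ge0_fin_numE.
  apply/seteqP; split => -[x t]; rewrite /preimage/= /u /c /= theadE.
    by rewrite (_ : [tuple of _] = t)//; apply/val_inj.
  by rewrite (_ : [tuple of _] = t)//; apply/val_inj.
exists (sigma_finite_alias h).
apply/funext => A; rewrite /P/P0/= /pushforward /product_measure1/=.
apply: eq_integral => x _; rewrite -mE; congr (m _).
by apply/seteqP; split => t; rewrite /xsection/= inE.
Qed.

(** * Orthonormal families of square-integrable functions *)

Definition lc (T : Type) (R : realType) k (a : 'I_k -> R) (F : 'I_k -> T -> R) : T -> R :=
  fun x => \sum_j a j * F j x.

Section square_integrable.
Context d (T : measurableType d) (R : realType) (m : {measure set T -> \bar R}).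
Implicit Types f g h : T -> R.

Definition sqint f := measurable_fun setT f /\
  m.-integrable setT (EFin \o (fun x => f x ^+ 2)).

(** Only a semidefinite form, since functions are not identified almost everywhere. [Rintegral] is
    real-valued even for divergent integrals, whence the [sqint] hypotheses of the linearity
    rules. *)
Definition ip f g : R := \int[m]_x (f x * g x).

Lemma sqintP f : measurable_fun setT f ->
  (\int[m]_x (f x ^+ 2)%:E < +oo)%E -> sqint f.
Proof.
move=> mf foo; split => //; apply/integrableP; split.
  exact/measurable_EFinP/measurable_funX.
by under eq_integral do rewrite /= ger0_norm ?sqr_ge0//.
Qed.

Lemma sqint_mul f g : sqint f -> sqint g ->
  m.-integrable setT (EFin \o (fun x => f x * g x)).
Proof.
move=> [mf f2] [mg g2].
apply: (@le_integrable _ _ _ m setT _ _ (EFin \o (fun x => f x ^+ 2 + g x ^+ 2))) => //.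
- exact/measurable_EFinP/measurable_funM.
- move=> x _ /=; rewrite lee_fin [leRHS]ger0_norm ?addr_ge0 ?sqr_ge0//.
  rewrite normrM -(real_normK (num_real (f x))) -(real_normK (num_real (g x))).
  have := sqr_ge0 (`|f x| - `|g x|); rewrite !expr2.
  have := normr_ge0 (f x); have := normr_ge0 (g x); nra.
- exact: (integrableD measurableT f2 g2).
Qed.

Lemma sqint0 : sqint (fun=> 0).
Proof.
split; first exact: measurable_cst.
rewrite (_ : _ \o _ = cst 0%E); first exact: integrable0.
by apply/funext => x /=; rewrite expr0n.
Qed.

Lemma sqintZD a f g : sqint f -> sqint g -> sqint (fun x => a * f x + g x).
Proof.
move=> sf sg; have fg := sqint_mul sf sg.
case: sf sg => [mf f2] [mg g2]; split.
  by apply: measurable_funD => //; exact: measurable_funM.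
have h1 := integrableZl measurableT (a ^+ 2) f2.
have h2 := integrableZl measurableT (2 * a) fg.
have h := integrableD measurableT (integrableD measurableT h1 h2) g2.
apply: eq_integrable h => // x _ /=.
by rewrite -!EFinM -!EFinD; congr EFin; ring.
Qed.

Lemma sqintZ a f : sqint f -> sqint (fun x => a * f x).
Proof.
move=> sf; have := sqintZD a sf sqint0.
by under [X in sqint X -> _]eq_fun do rewrite addr0.
Qed.

Lemma sqintD f g : sqint f -> sqint g -> sqint (fun x => f x + g x).
Proof.
move=> sf sg; have := sqintZD 1 sf sg.
by under [X in sqint X -> _]eq_fun do rewrite mul1r.
Qed.

Lemma sqintB f g : sqint f -> sqint g -> sqint (fun x => f x - g x).
Proof.
move=> sf sg; have := sqintZD (-1) sg sf.
by under [X in sqint X -> _]eq_fun do rewrite mulN1r addrC.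
Qed.

Lemma sqint_sum k (F : 'I_k -> T -> R) :
  (forall j, sqint (F j)) -> sqint (fun x => \sum_j F j x).
Proof.
elim: k F => [|k ih] F sF.
  by under eq_fun do rewrite big_ord0; exact: sqint0.
under eq_fun do rewrite big_ord_recl.
by apply: sqintD => //; apply: (ih (fun j => F (lift ord0 j))).
Qed.

Lemma sqint_lc k (a : 'I_k -> R) (F : 'I_k -> T -> R) :
  (forall j, sqint (F j)) -> sqint (lc a F).
Proof. by move=> sF; apply: sqint_sum => j; exact: sqintZ. Qed.

Lemma ipC f g : ip f g = ip g f.
Proof. by rewrite /ip; apply: eq_Rintegral => x _; rewrite mulrC. Qed.

Lemma ipZDl a f g h : sqint f -> sqint g -> sqint h ->
  ip (fun x => a * f x + g x) h = a * ip f h + ip g h.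
Proof.
move=> sf sg sh; have fh := sqint_mul sf sh; have gh := sqint_mul sg sh.
rewrite /ip -RintegralZl// -RintegralD//; last exact: (integrableZl measurableT a fh).
by apply: eq_Rintegral => x _; ring.
Qed.

Lemma ip0l h : ip (fun=> 0) h = 0.
Proof.
rewrite /ip; under eq_Rintegral do rewrite mul0r.
by rewrite Rintegral_cst// mul0r.
Qed.

Lemma ipZl a f h : sqint f -> sqint h -> ip (fun x => a * f x) h = a * ip f h.
Proof.
move=> sf sh; have := ipZDl a sf sqint0 sh; rewrite ip0l addr0 => <-.
by congr ip; apply/funext => x; rewrite addr0.
Qed.

Lemma ipDl f g h : sqint f -> sqint g -> sqint h ->
  ip (fun x => f x + g x) h = ip f h + ip g h.
Proof.
move=> sf sg sh; have := ipZDl 1 sf sg sh; rewrite mul1r => <-.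
by congr ip; apply/funext => x; rewrite mul1r.
Qed.

Lemma ipBl f g h : sqint f -> sqint g -> sqint h ->
  ip (fun x => f x - g x) h = ip f h - ip g h.
Proof.
move=> sf sg sh; have := ipZDl (-1) sg sf sh; rewrite mulN1r addrC => <-.
by congr ip; apply/funext => x; rewrite mulN1r addrC.
Qed.

Lemma ip_lcl k (a : 'I_k -> R) (F : 'I_k -> T -> R) h :
  (forall j, sqint (F j)) -> sqint h -> ip (lc a F) h = \sum_j a j * ip (F j) h.
Proof.
move=> + sh; rewrite /lc; elim: k a F => [|k ih] a F sF.
  by under [X in ip X]eq_fun do rewrite big_ord0; rewrite big_ord0 ip0l.
under [X in ip X]eq_fun do rewrite big_ord_recl.
rewrite big_ord_recl ipDl//; last 2 first.
  exact: sqintZ.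
  by apply: (@sqint_lc _ (fun j => a (lift ord0 j)) (fun j => F (lift ord0 j))).
by rewrite ipZl// (ih (fun j => a (lift ord0 j)) (fun j => F (lift ord0 j))).
Qed.

Lemma ip_ge0 f : 0 <= ip f f.
Proof. by apply: Rintegral_ge0 => x _; rewrite -expr2 sqr_ge0. Qed.

Lemma ipE f : sqint f -> (\int[m]_x (f x ^+ 2)%:E)%E = (ip f f)%:E.
Proof.
move=> sf; rewrite /ip /Rintegral fineK.
  by apply: eq_integral => x _; rewrite expr2.
exact: (integrable_fin_num measurableT (sqint_mul sf sf)).
Qed.

(** The degenerate case of Cauchy-Schwarz: for [f] of norm zero, the squared norm of [t * f + g] is
    affine in [t] and nonnegative, so its slope vanishes. *)
Lemma ip_eq0 f g : sqint f -> sqint g -> ip f f = 0 -> ip f g = 0.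
Proof.
move=> sf sg f0.
have key t : 0 <= 2 * t * ip f g + ip g g.
  have := ip_ge0 (fun x => t * f x + g x).
  rewrite ipZDl//; last exact: sqintZD.
  rewrite [X in t * X]ipC [X in _ + X]ipC !ipZDl// f0 (ipC g f) => h.
  by apply: le_trans h _; lra.
apply: contrapT => /eqP fg0.
(* At this [t] the affine function would equal -1. *)
have := key (- (ip g g + 1) / (2 * ip f g)).
have -> : 2 * (- (ip g g + 1) / (2 * ip f g)) * ip f g = - (ip g g + 1) by field.
lra.
Qed.

Definition orthonormal_fam k (eta : 'I_k -> T -> R) :=
  (forall j, sqint (eta j)) /\ forall i j, ip (eta i) (eta j) = (i == j)%:R.

Lemma ip_lc_on k (eta : 'I_k -> T -> R) a j : orthonormal_fam eta ->
  ip (lc a eta) (eta j) = a j.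
Proof.
move=> [seta on]; rewrite ip_lcl// (bigD1 j)//= on eqxx mulr1 big1 ?addr0// => i ij.
by rewrite on (negbTE ij) mulr0.
Qed.

Lemma pythagoras k (eta : 'I_k -> T -> R) r a : orthonormal_fam eta -> sqint r ->
  (forall j, ip r (eta j) = 0) ->
  ip (fun x => r x + lc a eta x) (fun x => r x + lc a eta x) =
  ip r r + \sum_j a j ^+ 2.
Proof.
move=> on sr r0; have [seta _] := on.
have sl := sqint_lc a seta; have srl := sqintD sr sl.
rewrite ipDl// ipC ipDl// (ipC (lc a eta) (fun x => _ + _)) ipDl//.
have rl : ip (lc a eta) r = 0.
  by rewrite ip_lcl// big1// => j _; rewrite ipC r0 mulr0.
rewrite rl (ipC r) rl addr0 add0r ip_lcl//; congr (_ + _).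
by apply: eq_bigr => j _; rewrite ipC ip_lc_on// expr2.
Qed.

Definition res k (eta : 'I_k -> T -> R) f : T -> R :=
  fun x => f x - lc (fun j => ip f (eta j)) eta x.

Lemma sqint_res k (eta : 'I_k -> T -> R) f : orthonormal_fam eta -> sqint f ->
  sqint (res eta f).
Proof. by move=> [seta _] sf; apply: sqintB => //; exact: sqint_lc. Qed.

Lemma res_orth k (eta : 'I_k -> T -> R) f j : orthonormal_fam eta -> sqint f ->
  ip (res eta f) (eta j) = 0.
Proof.
move=> on sf; have [seta _] := on.
by rewrite ipBl//; [rewrite ip_lc_on// subrr|exact: sqint_lc].
Qed.

Lemma res_min k (eta : 'I_k -> T -> R) f a : orthonormal_fam eta -> sqint f ->
  ip (res eta f) (res eta f) <=
  ip (fun x => f x - lc a eta x) (fun x => f x - lc a eta x).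
Proof.
move=> on sf.
have := @pythagoras _ eta (res eta f) (fun j => ip f (eta j) - a j) on
  (sqint_res on sf) (fun j => res_orth j on sf).
rewrite (_ : (fun x => _ + _) = (fun x => f x - lc a eta x)) => [->|].
  by rewrite lerDl sumr_ge0// => j _; exact: sqr_ge0.
apply/funext => x; rewrite /res /lc -addrA; congr (_ + _).
rewrite addrC -sumrB -sumrN; apply: eq_bigr => j _; ring.
Qed.

(** For [k > n] the coefficient matrix has a nonzero left kernel vector [u], which gives a vanishing
    combination of the [eta j]; pairing it with each [eta j] forces [u = 0]. *)
Lemma orthonormal_dim n k (c : 'I_n -> T -> R) (eta : 'I_k -> T -> R) :
  orthonormal_fam eta -> (forall j, exists a, eta j = lc a c) -> (k <= n)%N.
Proof.
move=> on /choice[M etaE]; rewrite leqNgt; apply/negP => nk.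
pose A : 'M[R]_(k, n) := \matrix_(i, j) M i j.
have /rowV0Pn[u uA u0] : kermx A != 0.
  by rewrite kermx_eq0 /row_free neq_ltn (leq_ltn_trans (rank_leq_col A) nk).
have uA0 : u *m A = 0 by apply/sub_kermxP.
have l0 : lc (fun i => u 0 i) eta = fun=> 0.
  apply/funext => x; rewrite /lc.
  transitivity (\sum_j (u *m A) 0 j * c j x).
    under eq_bigr do rewrite etaE /lc mulr_sumr.
    rewrite exchange_big/=; apply: eq_bigr => j _.
    by rewrite mxE mulr_suml; apply: eq_bigr => i _; rewrite mxE mulrA.
  by rewrite uA0 big1// => j _; rewrite mxE mul0r.
case/negP: u0; apply/eqP/rowP => j.
by rewrite mxE -(@ip_lc_on _ eta (fun i => u 0 i) j on) l0 ip0l.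
Qed.

(** The spanning functions [c j] may lie outside L_2, which rules out Gram-Schmidt on them. Instead
    an orthonormal family in [S] of maximal size is taken: a residual of positive norm could be
    normalised and added to it. *)
Lemma orthonormal_basis n (c : 'I_n -> T -> R) (S : set (T -> R)) :
  (forall f, S f -> sqint f) -> S (fun=> 0) ->
  (forall a f g, S f -> S g -> S (fun x => a * f x + g x)) ->
  (forall f, S f -> exists a, f = lc a c) ->
  exists k (eta : 'I_k -> T -> R), [/\ (k <= n)%N, orthonormal_fam eta,
    forall j, S (eta j) & forall f, S f -> ip (res eta f) (res eta f) = 0].
Proof.
move=> Ssq S0 Slin Sc.
pose P k := `[< exists eta : 'I_k -> T -> R, orthonormal_fam eta /\ forall j, S (eta j) >].
have exP : exists k, P k.
  by exists 0; apply/asboolP; exists (fun=> fun=> 0); split; [split|]; case.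
have ubP k : P k -> (k <= n)%N.
  by move=> /asboolP[eta [on Se]]; apply: (orthonormal_dim on) => j; exact: Sc.
case: (ex_maxnP exP ubP) => k /[dup] /ubP kn /asboolP[eta [on Se]] kmax.
exists k, eta; split=> // f Sf; apply: contrapT => /eqP r0.
have rgt0 : 0 < ip (res eta f) (res eta f) by rewrite lt_neqAle eq_sym r0 ip_ge0.
pose s := (Num.sqrt (ip (res eta f) (res eta f)))^-1.
have ss : s ^+ 2 * ip (res eta f) (res eta f) = 1.
  by rewrite exprVn sqr_sqrtr ?ip_ge0// mulVf.
have Slc l (b : 'I_l -> R) (F : 'I_l -> T -> R) : (forall j, S (F j)) -> S (lc b F).
  elim: l b F => [|l ih] b F SF; rewrite /lc.
    by under eq_fun do rewrite big_ord0.
  under eq_fun do rewrite big_ord_recl.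
  by apply: Slin => //; apply: (ih (fun j => b (lift ord0 j)) (fun j => F (lift ord0 j))).
have Sr : S (fun x => s * res eta f x).
  have := Slin 0 _ _ S0 S0 => _.
  have h := Slin (- s) _ _ (Slc _ (fun j => ip f (eta j)) eta Se) S0.
  have := Slin s _ _ Sf h; congr S; apply/funext => x; rewrite /res; ring.
have sr : sqint (res eta f) by apply: sqint_res => //; exact: Ssq.
pose eta' (j : 'I_k.+1) := if unlift ord0 j is Some i then eta i else fun x => s * res eta f x.
have e0 : eta' ord0 = fun x => s * res eta f x by rewrite /eta' unlift_none.
have eS i : eta' (lift ord0 i) = eta i by rewrite /eta' liftK.
have Se' j : S (eta' j).
  by case: (unliftP ord0 j) => [i|] ->; rewrite ?e0 ?eS.
have [seta one] := on.
have : (k.+1 <= k)%N; last by rewrite ltnn.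
apply: kmax; apply/asboolP; exists eta'; split => //; split.
  by move=> j; exact: Ssq.
have r_eta i : ip (fun x => s * res eta f x) (eta i) = 0.
  by rewrite ipZl// res_orth ?mulr0//; exact: Ssq.
move=> i j; case: (unliftP ord0 i) => [i'|] ->; case: (unliftP ord0 j) => [j'|] ->;
  rewrite ?e0 ?eS.
- by rewrite one (inj_eq lift_inj).
- by rewrite ipC r_eta.
- by rewrite r_eta.
- by rewrite ipZl//; [rewrite ipC ipZl// mulrA -expr2 ss eqxx|exact: sqintZ].
Qed.

End square_integrable.

(** * Interpolation at one point per dimension *)

(** The reflection in the hyperplane orthogonal to [u = v / s - e_0] swaps the unit vectors [v / s]
    and [e_0]. *)
Lemma householder (R : realType) k (v : 'I_k.+1 -> R) (s : R) : 0 < s ->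
  \sum_j v j ^+ 2 = s ^+ 2 ->
  exists H : 'M[R]_k.+1, H *m H^T = 1%:M /\
    forall i, \sum_j H i j * v j = if i == ord0 then s else 0.
Proof.
move=> s0 vs.
pose u : 'rV[R]_k.+1 := \row_j (v j / s - (j == ord0)%:R).
pose c := \sum_j u 0 j ^+ 2.
have uu : u *m u^T = c%:M.
  apply/matrixP => i j; rewrite !ord1 mxE [RHS]mxE eqxx mulr1n /c.
  by apply: eq_bigr => l _; rewrite [u^T _ _]mxE expr2.
have uv : \sum_j u 0 j * v j = s - v ord0.
  transitivity (\sum_j (v j ^+ 2 / s - (j == ord0)%:R * v j)).
    by apply: eq_bigr => j _; rewrite mxE; field; rewrite gt_eqF.
  rewrite sumrB -mulr_suml vs (bigD1 ord0)//= mul1r big1 ?addr0.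
    by field; rewrite gt_eqF.
  by move=> j /negbTE ->; rewrite mul0r.
have cE : c * s = 2 * (s - v ord0).
  transitivity ((\sum_j u 0 j * v j) - \sum_j u 0 j * (j == ord0)%:R * s).
    rewrite /c mulr_suml -sumrB; apply: eq_bigr => j _.
    by rewrite [u 0 j]mxE; field; rewrite gt_eqF.
  rewrite uv (bigD1 ord0)//= big1 ?addr0.
    by rewrite mxE/=; field; rewrite gt_eqF.
  by move=> j /negbTE ->; rewrite mulr0 mul0r.
(* If [v / s = e_0] then [c = 0], and division by zero makes [2 / c = 0], so that the matrix is the
   identity. *)
exists (1%:M - (2 / c) *: (u^T *m u)); split.
  have -> : (1%:M - (2 / c) *: (u^T *m u))^T = 1%:M - (2 / c) *: (u^T *m u).
    by apply/matrixP => i j; rewrite !mxE !big_ord1 !mxE eq_sym [X in _ - _ * X]mulrC.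
  rewrite mulmxBl mul1mx mulmxBr mulmx1 -scalemxAl -scalemxAr.
  rewrite -mulmxA (mulmxA u) uu mul_scalar_mx -scalemxAr !scalerA.
  have -> : 2 / c * (2 / c * c) = 2 / c + 2 / c.
    have [->|c0] := eqVneq c 0; first by rewrite invr0 !mulr0 addr0.
    by field.
  by rewrite scalerDl opprB addrK subrK.
move=> i.
transitivity (v i - 2 / c * u 0 i * \sum_j u 0 j * v j).
  rewrite mulr_sumr; transitivity (\sum_j ((i == j)%:R * v j - 2 / c * u 0 i * (u 0 j * v j))).
    apply: eq_bigr => j _; rewrite !mxE big_ord1 !mxE; ring.
  rewrite sumrB; congr (_ - _); rewrite (bigD1 i)//= eqxx mul1r big1 ?addr0//.
  by move=> j; rewrite eq_sym => /negbTE ->; rewrite mul0r.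
have vi : v i = s * (u 0 i + (i == ord0)%:R).
  by rewrite mxE subrK mulrC divfK// gt_eqF.
rewrite uv; have [c0|c0] := eqVneq c 0.
  have u0 : u 0 i = 0.
    have /eqP := c0; rewrite psumr_eq0 => [/allP/(_ i)|j _]; last exact: sqr_ge0.
    by rewrite mem_index_enum => /(_ isT) /=; rewrite sqrf_eq0 => /eqP.
  by rewrite c0 invr0 mulr0 !mul0r subr0 vi u0 add0r; case: eqP; rewrite ?mulr1 ?mulr0.
have -> : s - v ord0 = c * s / 2 by rewrite cE; field.
transitivity (s * (i == ord0)%:R).
  by rewrite vi; set b := (i == ord0)%:R; field.
by case: eqP; rewrite ?mulr1 ?mulr0.
Qed.

(** Under the probability density [N / K], the average of [K h / N] is at most [C], so some point of
    positive density does not exceed [C]. *)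
Lemma pick_point d (T : measurableType d) (R : realType)
    (m : {measure set T -> \bar R}) (N : T -> R) (h : T -> \bar R) (K C : R) :
  0 < K -> 0 <= C -> measurable_fun setT N -> (forall x, 0 <= N x) ->
  measurable_fun setT h -> (forall x, 0 <= h x)%E ->
  (\int[m]_x (N x)%:E = K%:E)%E -> (\int[m]_x h x <= C%:E)%E ->
  exists z, 0 < N z /\ (K%:E * h z <= (C * N z)%:E)%E.
Proof.
move=> K0 C0 mN N0 mh h0 NK hC; apply: contrapT => /forallNP nz.
have CNh z : 0 < N z -> ((C * N z)%:E < K%:E * h z)%E.
  by move=> Nz; rewrite ltNge; apply/negP => hz; apply: (nz z).
(* [q] is the excess of [K h] over [C N], cut to [0, 1]. Its integral is 0, so it vanishes almost
   everywhere, and by [CNh] so does [N], against [K > 0]. *)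
pose q z := maxe 0%E (mine 1%E (K%:E * h z - (C * N z)%:E)%E).
have mq : measurable_fun setT q.
  apply: measurable_maxe => //; apply: measurable_mine => //.
  apply: emeasurable_funB; first exact: measurable_funeM.
  exact/measurable_EFinP/measurable_funM.
have q0 z : (0 <= q z)%E by rewrite /q le_max lexx.
have qle z : ((C * N z)%:E + q z <= K%:E * h z)%E.
  have [Nz|Nz] := ltP 0 (N z); last first.
    have Nz0 : N z = 0 by apply/eqP; rewrite eq_le Nz N0.
    rewrite /q Nz0 mulr0 add0e sube0 ge_max mule_ge0//=; last by rewrite lee_fin ltW.
    by rewrite ge_min lexx orbT.
  have := CNh _ Nz => hz.
  rewrite addeC -leeBrDr// /q ge_max sube_ge0// ltW//=.
  by rewrite ge_min lexx orbT.
have iq0 : (\int[m]_x q x = 0)%E.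
  have : (\int[m]_x ((C * N x)%:E + q x) <= \int[m]_x (K%:E * h x))%E.
    apply: ge0_le_integral => //.
    - by move=> x _; rewrite adde_ge0// lee_fin mulr_ge0.
    - apply: emeasurable_funD => //; exact/measurable_EFinP/measurable_funM.
    - exact: measurable_funeM.
  rewrite ge0_integralD//; last 2 first.
  - by move=> x _; rewrite lee_fin mulr_ge0.
  - exact/measurable_EFinP/measurable_funM.
  under eq_integral do rewrite EFinM.
  rewrite !ge0_integralZl//; last 3 first.
  - by rewrite lee_fin ltW.
  - exact/measurable_EFinP.
  - by move=> x _; rewrite lee_fin.
  rewrite NK => hle.
  have : (C%:E * K%:E + \int[m]_x q x <= C%:E * K%:E)%E.
    apply: (le_trans hle); rewrite [leRHS]muleC; apply: lee_wpmul2l => //.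
    by rewrite lee_fin ltW.
  rewrite -EFinM addeC -leeBrDr// subee// => qle0.
  by apply/eqP; rewrite eq_le qle0 integral_ge0.
have /ae_eq_integral_abs qae := mq.
have : (\int[m]_x `|q x| = 0)%E.
  by rewrite -[RHS]iq0; apply: eq_integral => x _; rewrite gee0_abs.
move=> /(qae m measurableT) {}qae.
have : (\int[m]_x (N x)%:E = 0)%E.
  rewrite -[RHS](@integral0 _ _ _ m setT); apply: ae_eq_integral => //.
    exact/measurable_EFinP.
  apply: filterS qae => z /(_ I) qz _ /=; congr EFin.
  apply: contrapT => /eqP Nz0.
  have Nz : 0 < N z by rewrite lt_neqAle eq_sym Nz0 N0.
  move: qz; rewrite /q => /eqP; apply/negP; rewrite gt_eqF// lt_max ltxx orFb lt_min lte01 andTb.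
  by rewrite sube_gt0 CNh.
by rewrite NK => -[] /eqP; rewrite gt_eqF.
Qed.

Section interpolation.
Context d1 d2 (Om : measurableType d1) (T : measurableType d2) (R : realType).
Context (mu : {sigma_finite_measure set Om -> \bar R}).
Context (lam : {sigma_finite_measure set T -> \bar R}).

Lemma lc_comp k l (eta : 'I_k -> T -> R) (F : 'I_l -> T -> R) a :
  (forall i, exists b, F i = lc b eta) -> exists b, lc a F = lc b eta.
Proof.
move=> /choice[M FE]; exists (fun j => \sum_i a i * M i j).
apply/funext => x; rewrite /lc.
under eq_bigr do rewrite FE /lc mulr_sumr.
rewrite exchange_big/=; apply: eq_bigr => j _.
by rewrite mulr_suml; apply: eq_bigr => i _; rewrite mulrA.
Qed.

(** The Householder matrix of the vector of values at [z] makes one member carry all the mass at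
    [z]; the others form an orthonormal basis of the elements of the span that vanish there. *)
Lemma orthonormal_rotate k (eta : 'I_k.+1 -> T -> R) z :
  orthonormal_fam lam eta -> 0 < \sum_j eta j z ^+ 2 ->
  exists eta' : 'I_k.+1 -> T -> R, [/\ orthonormal_fam lam eta',
    eta' ord0 z ^+ 2 = \sum_j eta j z ^+ 2,
    forall j, eta' (lift ord0 j) z = 0,
    forall i, exists b, eta' i = lc b eta &
    forall i, exists b, eta i = lc b eta'].
Proof.
move=> on N0; have [seta one] := on.
have s0 : 0 < Num.sqrt (\sum_j eta j z ^+ 2) by rewrite sqrtr_gt0.
have ss : \sum_j eta j z ^+ 2 = (Num.sqrt (\sum_j eta j z ^+ 2)) ^+ 2.
  by rewrite sqr_sqrtr// ltW.
have [H [HH Hz]] := householder s0 ss.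
have HH' : H^T *m H = 1%:M by apply: mulmx1C.
exists (fun i => lc (H i) eta); split.
- split=> [j|i j]; first exact: sqint_lc.
  rewrite ip_lcl//; last exact: sqint_lc.
  transitivity ((H *m H^T) i j); last by rewrite HH mxE.
  by rewrite mxE; apply: eq_bigr => l _; rewrite ipC ip_lc_on// mxE.
- by rewrite /lc Hz eqxx -ss.
- by move=> j; rewrite /lc Hz.
- by move=> i; exists (H i).
- move=> i; exists (fun l => H l i); apply/funext => x; rewrite /lc.
  under eq_bigr do rewrite mulr_sumr.
  rewrite exchange_big/=.
  transitivity (\sum_j (H^T *m H) i j * eta j x).
    rewrite HH' (bigD1 i)//= mxE eqxx mul1r big1 ?addr0// => j ji.
    by rewrite mxE eq_sym (negbTE ji) mul0r.
  apply: eq_bigr => j _; rewrite mxE mulr_suml; apply: eq_bigr => l _.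
  by rewrite mxE mulrA.
Qed.

Lemma integral_sum_sqr k (eta : 'I_k -> T -> R) : orthonormal_fam lam eta ->
  (\int[lam]_x (\sum_j eta j x ^+ 2)%:E = k%:R%:E)%E.
Proof.
move=> [seta one].
under eq_integral do rewrite -sumEFin.
rewrite ge0_integral_sum//; last 2 first.
- by move=> j; apply/measurable_EFinP/measurable_funX; case: (seta j).
- by move=> j x _; rewrite lee_fin sqr_ge0.
under eq_bigr do rewrite ipE// one eqxx.
by rewrite sumEFin sumr_const card_ord.
Qed.

(* A sampling point drawn with density proportional to [\sum_j eta j ^+ 2]
   inflates the expected residual by [1 + 1/k]; these factors telescope to
   [k + 1] while the dimension drops from [k] to [0]. *)
Lemma interpolation k (eta : 'I_k -> T -> R) (Z : Om -> T -> R) (C : R) :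
  orthonormal_fam lam eta -> 0 <= C ->
  measurable_fun setT (fun p : Om * T => Z p.1 p.2) ->
  (forall w, sqint lam (Z w)) -> (forall w j, ip lam (Z w) (eta j) = 0) ->
  (\int[mu]_w \int[lam]_x (Z w x ^+ 2)%:E <= C%:E)%E ->
  exists (z : 'I_k -> T) (g : 'I_k -> T -> R),
  [/\ forall i, exists j, eta j (z i) != 0,
      forall i, exists a, g i = lc a eta,
      forall a x, lc a eta x = \sum_i lc a eta (z i) * g i x &
      (\int[mu]_w \int[lam]_x ((Z w x - \sum_i Z w (z i) * g i x) ^+ 2)%:E
         <= (k.+1%:R * C)%:E)%E].
Proof.
elim: k eta Z C => [|k ih] eta Z C on C0 mZ sZ Z0 ZC.
  have z0 : 'I_0 -> T by case.
  exists z0, (fun=> fun=> 0); split; [by case|by case| |].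
    by move=> a x; rewrite /lc !big_ord0.
  rewrite mul1r; apply: le_trans ZC.
  by under eq_integral do under eq_integral do rewrite big_ord0 subr0.
have [seta one] := on.
pose N z := \sum_j eta j z ^+ 2.
have mN : measurable_fun setT N.
  by apply: measurable_sum => j; apply: measurable_funX; case: (seta j).
have mZ2 : measurable_fun setT (fun p : Om * T => (Z p.1 p.2 ^+ 2)%:E).
  exact/measurable_EFinP/measurable_funX.
have Z20 (p : Om * T) : (0 <= (Z p.1 p.2 ^+ 2)%:E)%E by rewrite lee_fin sqr_ge0.
pose h z := (\int[mu]_w (Z w z ^+ 2)%:E)%E.
have K0 : 0 < k.+1%:R :> R by rewrite ltr0n.
have [z [Nz0 hz]] : exists z, 0 < N z /\ (k.+1%:R%:E * h z <= (C * N z)%:E)%E.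
  apply: (@pick_point _ T R lam N h k.+1%:R C) => //.
  - by move=> x; apply: sumr_ge0 => j _; exact: sqr_ge0.
  - exact: (measurable_fun_fubini_tonelli_G (m1 := mu) _ mZ2 Z20).
  - by move=> x; apply: integral_ge0 => w _; rewrite lee_fin sqr_ge0.
  - exact: integral_sum_sqr.
  - by rewrite /h -(fubini_tonelli (m1 := mu) (m2 := lam) _ mZ2 Z20).
have [eta' [on' e0 eS e_eta eta_e]] := orthonormal_rotate on Nz0.
have [seta' one'] := on'.
have e00 : eta' ord0 z != 0 by rewrite -sqrf_eq0 e0 gt_eqF.
(* The multiple of [eta' ord0] with value 1 at [z]; its squared norm is [1 / N z]. Subtracting
   [Z w z * q] makes the residual vanish at [z] and keeps it orthogonal to the remaining
   functions. *)
pose q x := eta' ord0 x / eta' ord0 z.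
pose Z' w x := Z w x - Z w z * q x.
pose eta'' j := eta' (lift ord0 j).
have on'' : orthonormal_fam lam eta''.
  by split=> [j|i j]; [exact: seta'|rewrite /eta'' one' (inj_eq lift_inj)].
have Ze w i : ip lam (Z w) (eta' i) = 0.
  have [b ->] := e_eta i; rewrite ipC ip_lcl// big1// => j _.
  by rewrite ipC Z0 mulr0.
have Z'E w x : Z' w x = Z w x + (- (Z w z / eta' ord0 z)) * eta' ord0 x.
  by rewrite /Z' /q; ring.
have sq : sqint lam q.
  by have := sqintZ (eta' ord0 z)^-1 (seta' ord0); congr sqint; apply/funext => x; rewrite mulrC.
have sZ' w : sqint lam (Z' w) by apply: sqintB => //; exact: sqintZ.
have mZz : measurable_fun setT (fun w => Z w z).
  exact: (measurableT_comp mZ (measurable_pair2 z)).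
have mZ' : measurable_fun setT (fun p : Om * T => Z' p.1 p.2).
  apply: measurable_funB => //; apply: measurable_funM.
    exact: (measurableT_comp mZz).
  by apply: (measurableT_comp _ measurable_snd); case: sq.
have Z'0 w j : ip lam (Z' w) (eta'' j) = 0.
  rewrite (_ : Z' w = fun x => - (Z w z / eta' ord0 z) * eta' ord0 x + Z w x).
    rewrite (ipZDl _ (seta' ord0) (sZ w) (seta' (lift ord0 j))) Ze one'.
    by rewrite (negbTE (neq_lift _ _)) mulr0 addr0.
  by apply/funext => x; rewrite Z'E addrC.
have Z'n w : (\int[lam]_x (Z' w x ^+ 2)%:E =
    \int[lam]_x (Z w x ^+ 2)%:E + ((N z)^-1)%:E * (Z w z ^+ 2)%:E)%E.
  rewrite !ipE// -EFinM -EFinD; congr EFin.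
  pose a (i : 'I_k.+1) := if i == ord0 then - (Z w z / eta' ord0 z) else 0.
  have lcE x : lc a eta' x = - (Z w z / eta' ord0 z) * eta' ord0 x.
    by rewrite /lc (bigD1 ord0)//= big1 ?addr0// => j /negbTE j0; rewrite /a j0 mul0r.
  have -> : Z' w = fun x => Z w x + lc a eta' x.
    by apply/funext => x; rewrite lcE Z'E.
  rewrite pythagoras//; congr (_ + _).
  rewrite (bigD1 ord0)//= big1 ?addr0.
    by rewrite /a eqxx sqrrN expr_div_n e0 mulrC.
  by move=> j /negbTE j0; rewrite /a j0 expr0n.
(* By [hz], the mean of [Z w z ^+ 2 / N z] is at most [C / (k + 1)]. *)
pose C' := C * (1 + k.+1%:R^-1).
have C'0 : 0 <= C' by rewrite mulr_ge0// addr_ge0// invr_ge0 ltW.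
have Z'C : (\int[mu]_w \int[lam]_x (Z' w x ^+ 2)%:E <= C'%:E)%E.
  under eq_integral do rewrite Z'n.
  rewrite ge0_integralD//; last 4 first.
  - by move=> w _; apply: integral_ge0 => x _; rewrite lee_fin sqr_ge0.
  - exact: (measurable_fun_fubini_tonelli_F (m2 := lam) _ mZ2 Z20).
  - by move=> w _; rewrite -EFinM lee_fin mulr_ge0 ?sqr_ge0// invr_ge0 ltW.
  - by apply: measurable_funeM; exact/measurable_EFinP/measurable_funX.
  rewrite ge0_integralZl//; last 3 first.
  - exact/measurable_EFinP/measurable_funX.
  - by move=> w _; rewrite lee_fin sqr_ge0.
  - by rewrite lee_fin invr_ge0 ltW.
  rewrite /C' mulrDr mulr1 EFinD leeD//.
  have : ((k.+1%:R^-1 * (N z)^-1)%:E * (k.+1%:R%:E * h z) <=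
          (k.+1%:R^-1 * (N z)^-1)%:E * (C * N z)%:E)%E.
    by apply: lee_wpmul2l => //; rewrite lee_fin mulr_ge0// invr_ge0 ltW.
  rewrite muleA -!EFinM.
  have -> : k.+1%:R^-1 / N z * k.+1%:R = (N z)^-1 by field; rewrite !gt_eqF.
  have -> // : k.+1%:R^-1 / N z * (C * N z) = C / k.+1%:R by field; rewrite !gt_eqF.
have [z' [g' [nz' g'e rep' errC]]] := ih eta'' Z' C' on'' C'0 mZ' sZ' Z'0 Z'C.
pose zz (i : 'I_k.+1) := if unlift ord0 i is Some j then z' j else z.
(* Interpolating with [q] at [z], and then the remainder with the [g'] at the points [z'], amounts
   to using this corrected function for the point [z]. *)
pose g0 x := q x - \sum_i q (z' i) * g' i x.
pose gg (i : 'I_k.+1) := if unlift ord0 i is Some j then g' j else g0.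
have zz0 : zz ord0 = z by rewrite /zz unlift_none.
have zzS i : zz (lift ord0 i) = z' i by rewrite /zz liftK.
have gg0 : gg ord0 = g0 by rewrite /gg unlift_none.
have ggS i : gg (lift ord0 i) = g' i by rewrite /gg liftK.
have sumE (v : T -> R) x : \sum_i v (zz i) * gg i x =
    v z * q x + \sum_i (v (z' i) - v z * q (z' i)) * g' i x.
  rewrite big_ord_recl zz0 gg0 /g0 mulrBr -addrA; congr (_ + _).
  rewrite addrC mulr_sumr -sumrB; apply: eq_bigr => i _.
  by rewrite zzS ggS mulrBl mulrA.
have g'eta i : exists a, g' i = lc a eta.
  have [a ->] := g'e i; apply: lc_comp => j; exact: e_eta.
exists zz, gg; split.
- move=> i; case: (unliftP ord0 i) => [j|] ->; rewrite ?zz0 ?zzS.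
    have [l /eqP nzl] := nz' j; apply: contrapT => /forallNP nz; apply: nzl.
    rewrite /eta''; have [b ->] := e_eta (lift ord0 l); rewrite /lc big1// => m _.
    by have /negP := nz m; rewrite negbK => /eqP ->; rewrite mulr0.
  apply: contrapT => /forallNP nz; move: Nz0; rewrite /N big1 ?ltxx// => m _.
  by have /negP := nz m; rewrite negbK => /eqP ->; rewrite expr0n.
- move=> i; case: (unliftP ord0 i) => [j|] ->; rewrite ?gg0 ?ggS//.
  have [b bE] := e_eta ord0; have [M g'M] := choice g'eta.
  have [c cE] := @lc_comp _ _ eta g' (fun i => q (z' i)) g'eta.
  exists (fun j => b j / eta' ord0 z - c j); apply/funext => x.
  have -> : g0 x = q x - lc (fun i => q (z' i)) g' x by [].
  rewrite cE /q bE /lc mulr_suml -sumrB; apply: eq_bigr => j _; ring.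
- move=> a x; rewrite sumE.
  have [b ->] := @lc_comp _ _ eta' eta a eta_e.
  have lcE y : lc b eta' y = b ord0 * eta' ord0 y + lc (fun j => b (lift ord0 j)) eta'' y.
    by rewrite /lc big_ord_recl.
  have bz : lc b eta' z = b ord0 * eta' ord0 z.
    by rewrite lcE [lc _ eta'' z]/lc big1 ?addr0// => j _; rewrite /eta'' eS mulr0.
  rewrite bz lcE rep'; congr (_ + _); first by rewrite /q; field.
  apply: eq_bigr => i _; congr (_ * _); rewrite lcE /q; field.
  exact: e00.
- apply: le_trans (le_trans errC _).
    rewrite le_eqVlt; apply/orP; left; apply/eqP.
    apply: eq_integral => w _; apply: eq_integral => x _.
    by rewrite sumE /Z' opprD addrA.
  rewrite lee_fin le_eqVlt; apply/orP; left; apply/eqP.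
  rewrite /C' [k.+2%:R]mulrSr; field.
  by rewrite gt_eqF.
Qed.

End interpolation.

(** * The Cramer-Wold theorem *)

(* Its iterates converge to [Num.sg] pointwise on [-1, 1], which replaces a
   Weierstrass approximation in [multiplier_sg]. *)
Definition cubic {R : realType} (s : R) : R := (3 * s - s ^+ 3) / 2.

Lemma iter_cubicN {R : realType} k (s : R) : iter k cubic (- s) = - iter k cubic s.
Proof. by elim: k => //= k ->; rewrite /cubic; field. Qed.

(** [1 + cubic a] and [1 - cubic a] both factor through a square, times a linear factor that is
    positive on [-1, 1]. *)
Lemma iter_cubic_norm {R : realType} k (s : R) : `|s| <= 1 -> `|iter k cubic s| <= 1.
Proof.
move=> s1; elim: k => //= k; set a := iter k _ _.
rewrite !ler_norml => /andP[a1 a2].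
have -> : cubic a = (1 + a) ^+ 2 * (2 - a) / 2 - 1 by rewrite /cubic; field.
have e : (1 + a) ^+ 2 * (2 - a) / 2 = 2 - (1 - a) ^+ 2 * (2 + a) / 2 by field.
have h1 : 0 <= (1 + a) ^+ 2 * (2 - a) by apply: mulr_ge0; [exact: sqr_ge0|lra].
have h2 : 0 <= (1 - a) ^+ 2 * (2 + a) by apply: mulr_ge0; [exact: sqr_ge0|lra].
by apply/andP; split; lra.
Qed.

(** [1 - cubic a] is [1 - a] times [(2 - a - a ^+ 2) / 2], a factor at most [1 - s / 2] as long as
    [a >= s]; the distance to 1 therefore decays geometrically. *)
Lemma iter_cubic_gt0 {R : realType} k (s : R) : 0 < s -> s <= 1 ->
  [/\ s <= iter k cubic s, iter k cubic s <= 1 & 1 - iter k cubic s <= (1 - s / 2) ^+ k].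
Proof.
move=> s0 s1; elim: k => [|k [sa a1 ih]]; first by rewrite expr0 /=; split => //; lra.
rewrite iterS; set a := iter k _ _ in sa a1 ih *.
have -> : cubic a = 1 - (1 - a) * ((2 - a - a ^+ 2) / 2) by rewrite /cubic; field.
have a0 : 0 < a by lra.
have aa : 0 <= a * (1 - a) by apply: mulr_ge0; lra.
have h1 : 0 <= (2 - a - a ^+ 2) / 2 by rewrite expr2; lra.
have h2 : (2 - a - a ^+ 2) / 2 <= 1 - s / 2 by have := sqr_ge0 a; lra.
have h3 : (2 - a - a ^+ 2) / 2 <= 1 by lra.
have h4 : 0 <= (1 - a) * ((2 - a - a ^+ 2) / 2) by apply: mulr_ge0; lra.
have h5 : (1 - a) * ((2 - a - a ^+ 2) / 2) <= 1 - a by apply: ler_piMr => //; lra.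
split; [lra|lra|].
rewrite subKr [leRHS]exprSr.
by apply: ler_pM => //; lra.
Qed.

Lemma cvg_iter_cubic {R : realType} (s : R) : `|s| <= 1 ->
  (fun k => iter k cubic s) @ \oo --> Num.sg s.
Proof.
have pos (u : R) : 0 < u -> u <= 1 -> (fun k => iter k cubic u) @ \oo --> (1 : R).
  move=> u0 u1.
  apply: (@squeeze_cvgr _ _ _ _ (fun k => 1 - (1 - u / 2) ^+ k) (fun=> 1)).
  - apply: nearW => k; have [h1 h2 h3] := iter_cubic_gt0 k u0 u1.
    by rewrite h2 andbT; lra.
  - rewrite -[X in _ --> X]subr0; apply: cvgB; first exact: cvg_cst.
    by apply: cvg_expr; rewrite ger0_norm; lra.
  - exact: cvg_cst.
move=> s1; have [s0|s0|s0] := ltgtP s 0.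
- rewrite ltr0_sg//.
  have -> : (fun k => iter k cubic s) = (fun k => - iter k cubic (- s)).
    by apply/funext => k; rewrite -iter_cubicN opprK.
  apply: cvgN; apply: pos; first by lra.
  by rewrite -ltr0_norm.
- by rewrite gtr0_sg//; apply: pos => //; rewrite -(gtr0_norm s0).
- rewrite s0 sgr0.
  have -> : (fun k => iter k cubic (0 : R)) = fun=> 0.
    by apply/funext => k; elim: k => //= k ->; rewrite /cubic; ring.
  exact: cvg_cst.
Qed.

(** The sequence is eventually constant: once [k + 1] exceeds the absolute value of [x], the
    argument lies in (-pi, pi), where the sine has the sign of its argument. *)
Lemma cvg_sg_sin {R : realType} (x : R) :
  (fun k : nat => Num.sg (sin (x / k.+1%:R))) @ \oo --> Num.sg x.
Proof.
have pos (y : R) : 0 < y -> \forall k \near \oo, Num.sg (sin (y / k.+1%:R)) = 1.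
  move=> y0; exists (Num.trunc y) => // k /= tk.
  have yk : y < k.+1%:R.
    by apply: lt_le_trans (truncnS_gt y) _; rewrite ler_nat.
  have h : 0 < k.+1%:R :> R by rewrite ltr0n.
  rewrite gtr0_sg// sin_gt0_pi// divr_gt0//=.
  rewrite ltr_pdivrMr//; apply: (lt_le_trans yk).
  by rewrite ler_peMl// ?ltW//; have := pi_ge2 R; lra.
apply: cvg_near_cst; have [x0|x0|->] := ltgtP x 0.
- rewrite ltr0_sg//; have := pos (- x); rewrite oppr_gt0 => /(_ x0).
  by apply: filterS => k; rewrite mulNr sinN sgrN => /eqP; rewrite eqr_oppLR => /eqP.
- by rewrite gtr0_sg//; exact: pos.
- by apply: nearW => k; rewrite mul0r sin0.
Qed.

Lemma integral_same_law d (Om : measurableType d) (R : realType)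
    (P : {measure set Om -> \bar R}) d' (T : measurableType d') (Y Y' : Om -> T) :
  measurable_fun setT Y -> measurable_fun setT Y' ->
  (forall B, measurable B -> P (Y @^-1` B) = P (Y' @^-1` B)) ->
  forall v : T -> \bar R, measurable_fun setT v ->
  (\int[P]_w v (Y w) = \int[P]_w v (Y' w))%E.
Proof.
move=> mY mY' same v mv.
pose D1 : {measure set T -> \bar R} := pushforward P Y.
pose D2 : {measure set T -> \bar R} := pushforward P Y'.
have key (u : T -> \bar R) : measurable_fun setT u -> (forall x, 0 <= u x)%E ->
    (\int[P]_w u (Y w) = \int[P]_w u (Y' w))%E.
  move=> mu u0.
  have h Z (mZ : measurable_fun setT Z) : (\int[pushforward P Z]_y u y = \int[P]_w u (Z w))%E.
    by rewrite ge0_integral_pushforward.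
  rewrite -!h//.
  by apply: (@eq_measure_integral _ _ _ setT (D2 mY') (D1 mY)) => A mA _; exact: same.
have h1 := key _ (measurable_funepos mv) (funepos_ge0 v).
have h2 := key _ (measurable_funeneg mv) (funeneg_ge0 v).
rewrite (integralE _ _ (fun w => v (Y w))) (integralE _ _ (fun w => v (Y' w))).
have e Z : ((fun w : Om => v (Z w))^\+ = (fun w => v^\+ (Z w)))%E.
  by apply/funext => w; rewrite !funeposE.
have e' Z : ((fun w : Om => v (Z w))^\- = (fun w => v^\- (Z w)))%E.
  by apply/funext => w; rewrite !funenegE.
by rewrite !e !e' h1 h2.
Qed.

Section cramer_wold.
Context d (Om : measurableType d) (R : realType) (P : probability Om R) (n : nat).
Context (X X' : Om -> n.-tuple R).
Context (mX : measurable_fun setT X) (mX' : measurable_fun setT X').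

Definition dot (b : 'I_n -> R) (y : n.-tuple R) : R := \sum_i b i * tnth y i.

Lemma measurable_dot b : measurable_fun setT (dot b).
Proof.
apply: measurable_sum => i; apply: measurable_funM => //.
exact: measurable_tnth.
Qed.

Context (same : forall b (B : set R), measurable B ->
  P ((dot b \o X) @^-1` B) = P ((dot b \o X') @^-1` B)).

Implicit Types h u : n.-tuple R -> R.

Definition bdd_meas h := measurable_fun setT h /\ exists M, forall y, `|h y| <= M.

Definition same_mean h := \int[P]_w h (X w) = \int[P]_w h (X' w).

Lemma integrable_bdd h (Y : Om -> n.-tuple R) : measurable_fun setT Y -> bdd_meas h ->
  P.-integrable setT (EFin \o (h \o Y)).
Proof.
move=> mY [mh [M hM]]; apply: measurable_bounded_integrable => //.
- by apply: (le_lt_trans (probability_le1 P measurableT)); rewrite ltry.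
- exact: measurableT_comp.
- by exists M; split; [exact: num_real|move=> N MN w _ /=; exact: le_trans (hM _) (ltW MN)].
Qed.

Lemma same_mean_lin a h u : bdd_meas h -> bdd_meas u -> same_mean h -> same_mean u ->
  same_mean (fun y => a * h y + u y).
Proof.
move=> bh bu hh hu; rewrite /same_mean.
have key (Y : Om -> n.-tuple R) : measurable_fun setT Y ->
    \int[P]_w (a * h (Y w) + u (Y w)) = a * \int[P]_w h (Y w) + \int[P]_w u (Y w).
  move=> mY; have ih := integrable_bdd mY bh; have iu := integrable_bdd mY bu.
  rewrite RintegralD//; last exact: (integrableZl measurableT a ih).
  by rewrite (RintegralZl _ measurableT ih).
by rewrite !key// hh hu.
Qed.

Lemma same_mean_lim (h_ : (n.-tuple R -> R)^nat) h M :
  (forall k, measurable_fun setT (h_ k)) -> measurable_fun setT h ->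
  (forall k y, `|h_ k y| <= M) -> (forall y, h_ ^~ y @ \oo --> h y) ->
  (forall k, same_mean (h_ k)) -> same_mean h.
Proof.
move=> mh_ mh hM hh sh.
have key (Y : Om -> n.-tuple R) : measurable_fun setT Y ->
    (fun k => \int[P]_w h_ k (Y w)) @ \oo --> \int[P]_w h (Y w).
  move=> mY.
  have [] := @dominated_convergence _ _ _ P setT measurableT
      (fun k w => (h_ k (Y w))%:E) (fun w => (h (Y w))%:E) (fun=> M%:E).
  - by move=> k; apply/measurable_EFinP; exact: measurableT_comp.
  - by apply/measurable_EFinP; exact: measurableT_comp.
  - by apply: aeW => w _; apply: cvg_EFin; [exact: nearW|exact: hh].
  - exact: finite_measure_integrable_cst.
  - by apply: aeW => w k _; rewrite lee_fin.
  move=> i1 _ cv; apply: fine_cvg; rewrite fineK//.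
  exact: integrable_fin_num.
have c1 := key _ mX; have c2 := key _ mX'.
have e : (fun k => \int[P]_w h_ k (X' w)) = fun k => \int[P]_w h_ k (X w).
  by apply/funext => k; exact/esym/(sh k).
rewrite e in c2; rewrite /same_mean -(cvg_lim _ c1)//; exact: cvg_lim.
Qed.

Lemma same_mean_dot b (v : R -> R) : measurable_fun setT v ->
  (exists M, forall s, `|v s| <= M) -> same_mean (v \o dot b).
Proof.
move=> mv bv.
have bh : bdd_meas (v \o dot b).
  split; first exact: (measurableT_comp mv (measurable_dot b)).
  by have [M vM] := bv; exists M => y; exact: vM.
have mb (Y : Om -> n.-tuple R) : measurable_fun setT Y -> measurable_fun setT (dot b \o Y).
  by move=> mY; exact: measurableT_comp (measurable_dot b) mY.
rewrite /same_mean /Rintegral; congr fine.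
apply: (@integral_same_law _ _ _ P _ _ (dot b \o X) (dot b \o X') (mb _ mX) (mb _ mX')
  (same b) (EFin \o v)).
exact/measurable_EFinP.
Qed.

(** Quantifying over all frequencies and phases makes the class stable under multiplication by a
    cosine; [b = 0], [t = 0] recovers equality of the means of [h] itself. *)
Definition good h := bdd_meas h /\
  forall b t, same_mean (fun y => h y * cos (dot b y + t)).

(* Cosines are multipliers by the product-to-sum formula, and multipliers form an
   algebra closed under bounded pointwise limits; hence the sets whose indicator is
   a multiplier form a sigma-algebra, which contains all half-spaces. *)
Definition multiplier u := bdd_meas u /\ forall h, good h -> good (fun y => u y * h y).

Lemma bdd_measM h u : bdd_meas h -> bdd_meas u -> bdd_meas (fun y => h y * u y).
Proof.
move=> [mh [M hM]] [mu [N uN]]; split; first exact: measurable_funM.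
by exists (M * N) => y; rewrite normrM ler_pM.
Qed.

Lemma bdd_meas_lin a h u : bdd_meas h -> bdd_meas u -> bdd_meas (fun y => a * h y + u y).
Proof.
move=> [mh [M hM]] [mu [N uN]]; split.
  by apply: measurable_funD => //; exact: measurable_funM.
exists (`|a| * M + N) => y; apply: (le_trans (ler_normD _ _)).
by rewrite normrM lerD// ler_wpM2l.
Qed.

Lemma bdd_meas_cos b t : bdd_meas (fun y => cos (dot b y + t)).
Proof.
split; last first.
  by exists 1 => y; rewrite ler_norml cos_geN1 cos_le1.
apply: (measurableT_comp (f := cos)).
  by apply: continuous_measurable_fun; exact: continuous_cos.
by apply: measurable_funD => //; exact: measurable_dot.
Qed.

Lemma good_lin a h u : good h -> good u -> good (fun y => a * h y + u y).
Proof.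
move=> [bh gh] [bu gu]; split=> [|b t]; first exact: bdd_meas_lin.
have := same_mean_lin a (bdd_measM bh (bdd_meas_cos b t))
  (bdd_measM bu (bdd_meas_cos b t)) (gh b t) (gu b t).
by congr same_mean; apply/funext => y; ring.
Qed.

Lemma good_lim (h_ : (n.-tuple R -> R)^nat) h M :
  (forall k y, `|h_ k y| <= M) -> (forall y, h_ ^~ y @ \oo --> h y) ->
  (forall k, good (h_ k)) -> good h.
Proof.
move=> hM hh gh.
have mh : measurable_fun setT h.
  by apply: (measurable_fun_cvg (h := h_)) => [k|y _]; [have [[]] := gh k|exact: hh].
have bh : bdd_meas h.
  split => //; exists M => y.
  have c : (fun k => `|h_ k y|) @ \oo --> `|h y| by apply: cvg_norm; exact: hh.
  rewrite -(cvg_lim _ c)//; apply: limr_le; first by apply/cvg_ex; eexists; exact: c.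
  exact: nearW.
split => // b t.
apply: (@same_mean_lim (fun k y => h_ k y * cos (dot b y + t)) _ M).
- by move=> k; have [bk _] := gh k; have [] := bdd_measM bk (bdd_meas_cos b t).
- by have [] := bdd_measM bh (bdd_meas_cos b t).
- move=> k y; rewrite normrM -[leRHS]mulr1 ler_pM//.
  by rewrite ler_norml cos_geN1 cos_le1.
- by move=> y; apply: cvgM => //; exact: cvg_cst.
- by move=> k; exact: (gh k).2.
Qed.

Lemma good1 : good (fun=> 1).
Proof.
split=> [|b t].
  by split; [exact: measurable_cst|exists 1 => y; rewrite normr1].
rewrite (_ : (fun y => _) = (fun s => cos (s + t)) \o dot b); last first.
  by apply/funext => y /=; rewrite mul1r.
apply: same_mean_dot.
  apply: (measurableT_comp (f := cos)).
    by apply: continuous_measurable_fun; exact: continuous_cos.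
  exact: measurable_funD.
by exists 1 => s; rewrite ler_norml cos_geN1 cos_le1.
Qed.

Lemma multiplier_cos b t : multiplier (fun y => cos (dot b y + t)).
Proof.
split=> [|h [bh gh]]; first exact: bdd_meas_cos.
split=> [|b' t']; first by apply: bdd_measM => //; exact: bdd_meas_cos.
have half g : bdd_meas g -> same_mean g -> same_mean (fun y => 2^-1 * g y).
  move=> bg sg; have b0 : bdd_meas (fun=> 0).
    by split; [exact: measurable_cst|exists 0 => y; rewrite normr0].
  have := @same_mean_lin 2^-1 g (fun=> 0) bg b0 sg erefl.
  by congr same_mean; apply/funext => y; rewrite addr0.
pose s1 := fun i => b i + b' i; pose s2 := fun i => b i - b' i.
have b1 := bdd_measM bh (bdd_meas_cos s1 (t + t')).
have b2 := bdd_measM bh (bdd_meas_cos s2 (t - t')).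
have := half _ (bdd_meas_lin 1 b1 b2) (same_mean_lin 1 b1 b2 (gh s1 (t + t')) (gh s2 (t - t'))).
congr same_mean; apply/funext => y.
have -> : dot s1 y + (t + t') = (dot b y + t) + (dot b' y + t').
  have -> : dot s1 y = dot b y + dot b' y.
    by rewrite /dot -big_split; apply: eq_bigr => i _; rewrite /s1 mulrDl.
  ring.
have -> : dot s2 y + (t - t') = (dot b y + t) - (dot b' y + t').
  have -> : dot s2 y = dot b y - dot b' y.
    by rewrite /dot -sumrB; apply: eq_bigr => i _; rewrite /s2 mulrBl.
  ring.
by rewrite cosD cosB; field.
Qed.

Lemma multiplierM u v : multiplier u -> multiplier v -> multiplier (fun y => u y * v y).
Proof.
move=> [bu mu] [bv mv]; split=> [|h gh]; first exact: bdd_measM.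
by have := mu _ (mv _ gh); congr good; apply/funext => y; rewrite mulrA.
Qed.

Lemma multiplier_lin a u v : multiplier u -> multiplier v ->
  multiplier (fun y => a * u y + v y).
Proof.
move=> [bu mu] [bv mv]; split=> [|h gh]; first exact: bdd_meas_lin.
have := good_lin a (mu _ gh) (mv _ gh).
by congr good; apply/funext => y; rewrite mulrDl mulrA.
Qed.

Lemma multiplier1 : multiplier (fun=> 1).
Proof.
split; first by have [] := good1.
by move=> h gh; move: (gh); congr good; apply/funext => y; rewrite mul1r.
Qed.

Lemma multiplier_lim (u_ : (n.-tuple R -> R)^nat) u M :
  (forall k y, `|u_ k y| <= M) -> (forall y, u_ ^~ y @ \oo --> u y) ->
  (forall k, multiplier (u_ k)) -> multiplier u.
Proof.
move=> uM uu mu; split.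
  have [] // := @good_lim u_ u M uM uu _.
  move=> k; have [_ /(_ _ good1)] := mu k.
  by congr good; apply/funext => y; rewrite mulr1.
move=> h gh; have [[mh [N hN]] _] := gh.
apply: (@good_lim (fun k y => u_ k y * h y) _ (M * N)).
- by move=> k y; rewrite normrM ler_pM.
- by move=> y; apply: cvgM => //; exact: cvg_cst.
- by move=> k; exact: (mu k).2.
Qed.

Lemma multiplierZ a u : multiplier u -> multiplier (fun y => a * u y).
Proof.
move=> mu; have m0 := multiplier_lin (-1) mu mu.
have := multiplier_lin a mu m0.
by congr multiplier; apply/funext => y; ring.
Qed.

(** Two nested limits: the sine of [(y_i - c) / (k + 1)] is a multiplier, hence so are its images
    under the iterated cubic, whose limit is the sign of the sine; letting [k] grow then gives the
    sign of [y_i - c]. *)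
Lemma multiplier_sg (i : 'I_n) (c : R) : multiplier (fun y => Num.sg (tnth y i - c)).
Proof.
apply: (@multiplier_lim (fun k y => Num.sg (sin ((tnth y i - c) / k.+1%:R))) _ 1).
- by move=> k y; rewrite normr_sg; case: (_ == _).
- by move=> y; exact: cvg_sg_sin.
move=> k.
have ms : multiplier (fun y => sin ((tnth y i - c) / k.+1%:R)).
  (* The phase [- pi / 2] turns the cosine into a sine. *)
  have := multiplier_cos (fun j => (j == i)%:R / k.+1%:R) (- (c / k.+1%:R) - pi / 2).
  congr multiplier; apply/funext => y.
  rewrite /dot (bigD1 i)//= eqxx big1 ?addr0; last first.
    by move=> j /negbTE ->; rewrite mul0r mul0r.
  rewrite -cosBpihalf; congr cos; rewrite mulr1n mulrBl mul1r mulrC addrA; congr (_ - _).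
apply: (@multiplier_lim (fun l y => iter l cubic (sin ((tnth y i - c) / k.+1%:R))) _ 1).
- by move=> l y; apply: iter_cubic_norm; rewrite ler_norml sin_geN1 sin_le1.
- by move=> y; apply: cvg_iter_cubic; rewrite ler_norml sin_geN1 sin_le1.
elim=> //= l; set v := fun y => iter l _ _ => mv.
have := multiplier_lin (3 / 2) mv (multiplierZ (- (2^-1)) (multiplierM mv (multiplierM mv mv))).
by congr multiplier; apply/funext => y; rewrite /cubic -/(v y); field.
Qed.

Definition multiplier_set (A : set (n.-tuple R)) := multiplier (\1_A : _ -> R).

Lemma multiplier_setC A : multiplier_set A -> multiplier_set (~` A).
Proof.
move=> mA; have := multiplier_lin (-1) mA multiplier1.
rewrite /multiplier_set; congr multiplier; apply/funext => y.
by rewrite !indicE in_setC; case: (y \in A) => /=; ring.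
Qed.

Lemma multiplier_setU A B : multiplier_set A -> multiplier_set B -> multiplier_set (A `|` B).
Proof.
move=> mA mB.
have := multiplier_lin 1 mA (multiplier_lin (-1) (multiplierM mA mB) mB).
rewrite /multiplier_set; congr multiplier; apply/funext => y.
by rewrite !indicE in_setU; case: (y \in A); case: (y \in B) => /=; ring.
Qed.

Lemma multiplier_set0 : multiplier_set set0.
Proof.
have := multiplierZ 0 multiplier1.
by rewrite /multiplier_set; congr multiplier; apply/funext => y; rewrite indic0 mul0r.
Qed.

Lemma multiplier_bigcup (A : (set (n.-tuple R))^nat) :
  (forall k, multiplier_set (A k)) -> multiplier_set (\bigcup_k A k).
Proof.
move=> mA.
apply: (@multiplier_lim (fun k => \1_(\big[setU/set0]_(i < k) A i)) _ 1).
- by move=> k y; rewrite indicE; case: (_ \in _); rewrite ?normr1 ?normr0.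
- move=> y; apply: cvg_near_cst; rewrite indicE.
  have [[j _ Ajy]|nA] := pselect ((\bigcup_k A k) y).
    exists j.+1 => // k /= jk; rewrite indicE !mem_set//; first by exists j.
    by rewrite -bigcup_mkord; exists j.
  apply: nearW => k; rewrite indicE !memNset// -bigcup_mkord => -[j _ Ajy].
  by apply: nA; exists j.
- elim=> [|k ih]; first by rewrite big_ord0; exact: multiplier_set0.
  by rewrite big_ord_recr; exact: multiplier_setU.
Qed.

Lemma measurable_multiplier A : measurable A -> multiplier_set A.
Proof.
have sal (i : 'I_n) : sigma_algebra setT [set B | multiplier_set (@tnth n R ^~ i @^-1` B)].
  split => /=.
  - by rewrite preimage_set0; exact: multiplier_set0.
  - by move=> B mB; rewrite setTD preimage_setC; exact: multiplier_setC.
  - by move=> F mF; rewrite preimage_bigcup; exact: multiplier_bigcup.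
apply: smallest_sub.
  split; first exact: multiplier_set0.
  - by move=> B mB; rewrite setTD; exact: multiplier_setC.
  - by move=> F mF; exact: multiplier_bigcup.
rewrite -bigcup_seq => C [i _ [B mB <-{C}]].
rewrite setTI.
have {}mB : (@ocitv R).-sigma.-measurable B := mB.
rewrite RGenOInfty.measurableE in mB.
move: B mB; apply: smallest_sub; first exact: sal.
move=> B [c ->]/=; rewrite /multiplier_set.
have ms := multiplier_sg i c.
(* [(s + s ^+ 2) / 2] is 1 at [s = 1] and 0 at [s = 0] and [s = -1]: applied to the sign, it is the
   indicator of the half-space. *)
have := multiplierZ 2^-1 (multiplier_lin 1 ms (multiplierM ms ms)).
congr multiplier; apply/funext => y; rewrite indicE/=.
have -> : (y \in (tnth (T:=R))^~ i @^-1` `]c, +oo[) = (0 < tnth y i - c).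
  by rewrite subr_gt0; apply/idP/idP; rewrite inE/= in_itv/= andbT.
by case: sgrP => _ /=; rewrite ?mulr0n ?mulr1n; [ring|field|field].
Qed.

Theorem cramer_wold A : measurable A -> P (X @^-1` A) = P (X' @^-1` A).
Proof.
move=> mA.
have [_ /(_ _ good1)[_ /(_ (fun=> 0) 0)]] := measurable_multiplier mA.
rewrite (_ : (fun y => _) = \1_A); last first.
  by apply/funext => y; rewrite /dot big1 ?addr0 ?cos0 ?mulr1// => i _; rewrite mul0r.
rewrite /same_mean.
have key (Y : Om -> n.-tuple R) : measurable_fun setT Y ->
    (\int[P]_w (\1_A (Y w)))%:E = P (Y @^-1` A).
  move=> mY; have mYA : measurable (Y @^-1` A) by rewrite -[X in measurable X]setTI; exact: mY.
  rewrite /Rintegral.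
  have -> : (\int[P]_w (\1_A (Y w))%:E = P (Y @^-1` A))%E.
    have h : (\int[P]_w (\1_(Y @^-1` A) w)%:E = P (Y @^-1` A))%E.
      by rewrite integral_indic// setIT.
    by rewrite -h; apply: eq_integral => w _; rewrite !indicE.
  by rewrite fineK// fin_num_measure.
by move=> e; rewrite -!key// e.
Qed.

End cramer_wold.

(** * Centred normal laws *)

(** The integral is moved to Lebesgue measure by a Radon-Nikodym derivative, and [y ^+ 2] times the
    density is dominated by a multiple of the normal density of doubled variance. *)
Lemma normal_second_moment (R : realType) (s : R) : 0 < s ->
  (\int[normal_prob 0 s]_y (y ^+ 2)%:E < +oo)%E.
Proof.
move=> s0; have s0' : s != 0 by rewrite gt_eqF.
pose nu : {finite_measure set (measurableTypeR R) -> \bar R} := normal_prob 0 s.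
pose la : {sigma_finite_measure set (measurableTypeR R) -> \bar R} := @lebesgue_measure R.
have dom : nu `<< la := normal_prob_dominates 0 s.
have m2 : measurable_fun setT (fun y : measurableTypeR R => (y ^+ 2)%:E).
  exact/measurable_EFinP/measurable_funX.
have mpdf : measurable_fun setT (fun y : measurableTypeR R => (normal_pdf 0 s y)%:E).
  apply/measurable_EFinP; exact: measurable_normal_pdf.
pose f := Radon_Nikodym_SigmaFinite.f nu la.
have fi : la.-integrable setT f := Radon_Nikodym_SigmaFinite.f_integrable dom.
have ae : ae_eq la setT f (fun y => (normal_pdf 0 s y)%:E).
  apply: integral_ae_eq => //= A _ mA.
  by rewrite -Radon_Nikodym_SigmaFinite.f_integral.
have -> : (\int[normal_prob 0 s]_y (y ^+ 2)%:E = \int[la]_y ((y ^+ 2)%:E * f y))%E.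
  rewrite (@Radon_Nikodym_SigmaFinite.change_of_variables _ _ _ nu la dom)//.
  by move=> x; rewrite lee_fin sqr_ge0.
have -> : (\int[la]_y ((y ^+ 2)%:E * f y) = \int[la]_y ((y ^+ 2) * normal_pdf 0 s y)%:E)%E.
  apply: ae_eq_integral => //.
  - by apply: emeasurable_funM => //; exact: measurable_int fi.
  - by apply/measurable_EFinP; apply: measurable_funM; [exact: measurable_funX|exact: measurable_normal_pdf].
  - by apply: filterS ae => y /= e yT; rewrite e.
pose s2 := Num.sqrt 2 * s.
have s20 : s2 != 0 by rewrite mulf_neq0// gt_eqF// sqrtr_gt0.
(* With [u = y ^+ 2 / (4 * s ^+ 2)] the integrand is the peak times [4 * s ^+ 2 * u * expR (- 2 u)],
   and [u * expR (- u) <= 1]; the ratio of the two peaks completes the constant. *)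
pose K := 4 * s ^+ 2 * normal_peak s / normal_peak s2.
have pk0 : 0 < normal_peak s by exact: normal_peak_gt0.
have pk20 : 0 < normal_peak s2 by exact: normal_peak_gt0.
apply: (@le_lt_trans _ _ (\int[la]_y (K%:E * (normal_pdf 0 s2 y)%:E))%E).
  apply: ge0_le_integral => //.
  - by move=> y _; rewrite lee_fin mulr_ge0 ?sqr_ge0 ?normal_pdf_ge0.
  - by apply/measurable_EFinP; apply: measurable_funM; [exact: measurable_funX|exact: measurable_normal_pdf].
  - by apply: measurable_funeM; apply/measurable_EFinP; exact: measurable_normal_pdf.
  move=> y _; rewrite lee_fin !normal_pdfE// /normal_fun !subr0.
  have -> : K * (normal_peak s2 * expR (- y ^+ 2 / (s2 ^+ 2 *+ 2))) =
     normal_peak s * (4 * s ^+ 2 * expR (- y ^+ 2 / (s2 ^+ 2 *+ 2))).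
    by rewrite /K; field; rewrite gt_eqF.
  rewrite [leLHS]mulrCA ler_pM2l//.
  have e2 : s2 ^+ 2 = 2 * s ^+ 2 by rewrite exprMn sqr_sqrtr.
  pose u := y ^+ 2 / (4 * s ^+ 2).
  have -> : y ^+ 2 = 4 * s ^+ 2 * u by rewrite /u; field.
  rewrite -(mulrA (4 * s ^+ 2) u) ler_pM2l; last by rewrite mulr_gt0// exprn_gt0.
  have -> : - (4 * s ^+ 2 * u) / (s ^+ 2 *+ 2) = - u - u by rewrite -mulr_natr; field.
  have -> : - (4 * s ^+ 2 * u) / (s2 ^+ 2 *+ 2) = - u by rewrite e2 -mulr_natr; field.
  rewrite expRD mulrA ler_piMl ?expR_ge0//.
  rewrite expRN ler_pdivrMr ?expR_gt0// mul1r.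
  by apply: le_trans (expR_ge1Dx u); rewrite lerDr.
rewrite integralZl//; last exact: integrable_normal_pdf.
by rewrite integral_normal_pdf mule1 ltry.
Qed.

Lemma normal_prob_set1 (R : realType) (s : R) : normal_prob 0 s [set 0] = 0%E.
Proof. by rewrite /normal_prob integral_set1. Qed.

Lemma normal_prob_itv (R : realType) (s r : R) : 0 < s -> 0 < r ->
  exists p, [/\ normal_prob 0 s `[- r, r]%classic = p%:E,
    2 * r * (normal_peak s * expR (- r ^+ 2 / (s ^+ 2 *+ 2))) <= p &
    p <= 2 * r * normal_peak s].
Proof.
move=> s0 r0; have s0' : s != 0 by rewrite gt_eqF.
pose la := @lebesgue_measure R.
pose I : set (measurableTypeR R) := `[- r, r]%classic.
have mI : measurable I by exact: measurable_itv.
have laI : la I = (2 * r)%:E.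
  rewrite /la /I lebesgue_measure_itv/= lte_fin ifT; last by lra.
  by rewrite -EFinD; congr EFin; ring.
have mpdf : measurable_fun I (fun y : measurableTypeR R => (normal_pdf 0 s y)%:E).
  by apply: measurable_funTS; apply/measurable_EFinP; exact: measurable_normal_pdf.
have ub : (normal_prob 0 s I <= (2 * r * normal_peak s)%:E)%E.
  rewrite mulrC EFinM -laI -integral_cst//; apply: ge0_le_integral => //.
  - by move=> y _; rewrite lee_fin normal_pdf_ge0.
  - by move=> y _; rewrite lee_fin normal_pdf_ub.
have lb : ((2 * r * (normal_peak s * expR (- r ^+ 2 / (s ^+ 2 *+ 2))))%:E <= normal_prob 0 s I)%E.
  rewrite mulrC EFinM -laI -integral_cst//; apply: ge0_le_integral => //.
  - by move=> y _; rewrite lee_fin mulr_ge0 ?expR_ge0 ?normal_peak_ge0.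
  - move=> y; rewrite /I/= in_itv/= => /andP[ry yr]; rewrite lee_fin normal_pdfE//.
    rewrite ler_pM2l ?normal_peak_gt0// /normal_fun subr0 ler_expR.
    rewrite ler_pM2r ?invr_gt0 ?mulrn_wgt0 ?exprn_gt0// lerN2.
    have : 0 <= (r - y) * (r + y) by apply: mulr_ge0; lra.
    by rewrite -subr_sqr subr_ge0.
exists (fine (normal_prob 0 s I)); split.
- by rewrite fineK// fin_num_measure.
- by rewrite -lee_fin fineK// fin_num_measure.
- by rewrite -lee_fin fineK// fin_num_measure.
Qed.

Lemma expR_limit_le (R : realType) (A B c : R) : 0 < c -> 0 < A ->
  (forall r, 0 < r -> A * expR (- (c * r ^+ 2)) <= B) -> A <= B.
Proof.
move=> c0 A0 H; rewrite leNgt; apply/negP => BA.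
(* Chosen so that [A * (1 - u)] is the midpoint of [A] and [B], while [expR (- u) >= 1 - u]; the
   radius is then taken with [c * r ^+ 2 = u]. *)
pose u := (A - B) / (2 * A).
have u0 : 0 < u by rewrite /u divr_gt0 ?subr_gt0 ?mulr_gt0.
have := H (Num.sqrt (u / c)); rewrite sqrtr_gt0 divr_gt0// => /(_ isT).
rewrite sqr_sqrtr; last by rewrite divr_ge0// ltW.
move=> h.
have e : c * (u / c) = u by field; rewrite gt_eqF.
rewrite e in h.
have h2 := ler_wpM2l (ltW A0) (expR_ge1Dx (- u)).
have h3 : A * u = (A - B) / 2 by rewrite /u; field; rewrite gt_eqF.
have := le_trans h2 h; rewrite mulrDr mulrN h3; lra.
Qed.

(** Dividing by [2 * r] and letting [r] tend to 0 compares the densities at 0: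
    [normal_peak s = a * normal_peak t], and the peak is inversely proportional to the standard
    deviation. *)
Lemma normal_prob_scale (R : realType) (s t a : R) : 0 < s -> 0 < t -> 0 < a ->
  (forall r, 0 < r -> normal_prob 0 s `[- r, r]%classic = normal_prob 0 t `[- (a * r), a * r]%classic) ->
  t = a * s.
Proof.
move=> s0 t0 a0 H.
have pks := @normal_peak_gt0 R s (lt0r_neq0 s0).
have pkt := @normal_peak_gt0 R t (lt0r_neq0 t0).
have h1 : a * normal_peak t <= normal_peak s.
  apply: (@expR_limit_le _ _ _ (a ^+ 2 / (t ^+ 2 *+ 2))).
  - by rewrite divr_gt0 ?exprn_gt0// mulrn_wgt0// exprn_gt0.
  - exact: mulr_gt0.
  move=> r r0; have ar0 : 0 < a * r by rewrite mulr_gt0.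
  have [p [pE _ pu]] := normal_prob_itv s0 r0.
  have [p' [p'E pl' _]] := normal_prob_itv t0 ar0.
  have pp : p' = p by apply: EFin_inj; rewrite -pE -p'E H.
  have : 2 * r * (a * normal_peak t * expR (- (a ^+ 2 / (t ^+ 2 *+ 2) * r ^+ 2))) <= 2 * r * normal_peak s.
    apply: le_trans pu; rewrite -pp; apply: le_trans pl'.
    rewrite le_eqVlt; apply/orP; left; apply/eqP.
    have -> : - (a * r) ^+ 2 / (t ^+ 2 *+ 2) = - (a ^+ 2 / (t ^+ 2 *+ 2) * r ^+ 2).
      by rewrite -mulr_natr; field; rewrite gt_eqF.
    ring.
  by rewrite ler_pM2l// mulr_gt0.
have h2 : normal_peak s <= a * normal_peak t.
  apply: (@expR_limit_le _ _ _ ((s ^+ 2 *+ 2)^-1)) => //.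
  - by rewrite invr_gt0 mulrn_wgt0// exprn_gt0.
  move=> r r0; have ar0 : 0 < a * r by rewrite mulr_gt0.
  have [p [pE pl _]] := normal_prob_itv s0 r0.
  have [p' [p'E _ pu']] := normal_prob_itv t0 ar0.
  have pp : p' = p by apply: EFin_inj; rewrite -pE -p'E H.
  have : 2 * r * (normal_peak s * expR (- ((s ^+ 2 *+ 2)^-1 * r ^+ 2))) <= 2 * r * (a * normal_peak t).
    have -> : - ((s ^+ 2 *+ 2)^-1 * r ^+ 2) = - r ^+ 2 / (s ^+ 2 *+ 2) by rewrite mulNr mulrC.
    apply: le_trans pl _; rewrite -pp; apply: le_trans pu' _.
    by rewrite le_eqVlt; apply/orP; left; apply/eqP; ring.
  by rewrite ler_pM2l// mulr_gt0.
have e : a * normal_peak t = normal_peak s by apply/eqP; rewrite eq_le h1 h2.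
have pkE (x : R) : 0 < x -> normal_peak x = (x * Num.sqrt (pi *+ 2))^-1.
  by move=> x0; rewrite /normal_peak -mulrnAr sqrtrM ?sqr_ge0// sqrtr_sqr gtr0_norm.
rewrite !pkE// !invfM mulrA in e.
have q0 : (Num.sqrt (pi *+ 2 : R))^-1 != 0.
  by rewrite invr_eq0 gt_eqF// sqrtr_gt0 mulrn_wgt0// pi_gt0.
have /mulIf := q0 => /(_ _ _ e) e'.
by rewrite -[t]mulr1 -[in LHS](divff (lt0r_neq0 s0)) [in LHS]mulrCA -e'; field; rewrite !gt_eqF.
Qed.

Section gaussian_law.
Context d (Om : measurableType d) (R : realType) (P : probability Om R).
Implicit Types X Y : Om -> R.

Definition gauss_law X :=
  (forall B : set R, measurable B -> P (X @^-1` B) = \d_(0 : R) B) \/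
  exists s : R, 0 < s /\
    forall B : set R, measurable B -> P (X @^-1` B) = normal_prob 0 s B.

Lemma integral_law (nu : {measure set (measurableTypeR R) -> \bar R}) X :
  measurable_fun setT X ->
  (forall B : set R, measurable B -> P (X @^-1` B) = nu B) ->
  forall v : R -> \bar R, measurable_fun setT v -> (forall y, 0 <= v y)%E ->
  (\int[P]_w v (X w) = \int[nu]_y v y)%E.
Proof.
move=> mX law v mv v0.
pose X' : Om -> measurableTypeR R := X.
have mX' : measurable_fun setT X' by exact: mX.
have mv' : measurable_fun setT (v : measurableTypeR R -> \bar R) by exact: mv.
have -> : (\int[P]_w v (X w) = \int[pushforward P X']_y v y)%E.
  by rewrite ge0_integral_pushforward.
pose D1 : {measure set (measurableTypeR R) -> \bar R} := pushforward P X'.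
by apply: (@eq_measure_integral _ _ _ setT nu (D1 mX')) => A mA _; exact: law.
Qed.

Lemma gauss_law_sqint X : measurable_fun setT X -> gauss_law X -> sqint P X.
Proof.
move=> mX gX; apply: sqintP => //.
have m2 : measurable_fun setT (fun y : R => (y ^+ 2)%:E).
  exact/measurable_EFinP/measurable_funX.
have p2 (y : R) : (0 <= (y ^+ 2)%:E)%E by rewrite lee_fin sqr_ge0.
case: gX => [law|[s [s0 law]]].
  by rewrite (integral_law (nu := \d_(0 : measurableTypeR R)) mX law m2 p2) integral_dirac// expr0n diracT mule0 ltry.
rewrite (integral_law (nu := normal_prob 0 s) mX law m2 p2).
exact: normal_second_moment.
Qed.

Lemma ip_dirac X : measurable_fun setT X ->
  (forall B : set R, measurable B -> P (X @^-1` B) = \d_(0 : R) B) -> ip P X X = 0.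
Proof.
move=> mX law; have sX : sqint P X by apply: gauss_law_sqint => //; left.
apply: EFin_inj; rewrite -ipE//.
have m2 : measurable_fun setT (fun y : R => (y ^+ 2)%:E).
  exact/measurable_EFinP/measurable_funX.
have p2 (y : R) : (0 <= (y ^+ 2)%:E)%E by rewrite lee_fin sqr_ge0.
by rewrite (integral_law (nu := \d_(0 : measurableTypeR R)) mX law m2 p2) integral_dirac// expr0n mule0.
Qed.

(** A vanishing second moment would put all the mass at 0, a point that a normal law does not
    charge. *)
Lemma ip_normal X s : measurable_fun setT X -> 0 < s ->
  (forall B : set R, measurable B -> P (X @^-1` B) = normal_prob 0 s B) -> ip P X X != 0.
Proof.
move=> mX s0 law; have sX : sqint P X by apply: gauss_law_sqint => //; right; exists s.
apply/negP => /eqP X0.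
have m0 : measurable ([set 0] : set R) by exact: measurable_set1.
pose E := X @^-1` [set 0].
have P0 : P E = 0%E by rewrite /E law// normal_prob_set1.
have mX0 : measurable E by rewrite -[X in measurable X]setTI; exact: mX.
have m2 : measurable_fun setT (fun w => (X w ^+ 2)%:E).
  by apply/measurable_EFinP; case: sX => mX' _; exact: measurable_funX.
have /ae_eq_integral_abs := m2 => /(_ P measurableT) [+ _].
have -> : (\int[P]_w `|(X w ^+ 2)%:E| = 0)%E.
  rewrite -[RHS]/(0%:E) -X0 -ipE//; apply: eq_integral => w _.
  by rewrite gee0_abs// lee_fin sqr_ge0.
move=> /(_ erefl) [N [mN N0 sN]].
have : (P (~` E) <= P N)%E.
  apply: le_measure; rewrite ?inE//; first exact: measurableC.
  apply: subset_trans sN => w /= Xw0 h; apply: Xw0.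
  by move: (h I) => -[] /eqP; rewrite sqrf_eq0 => /eqP.
rewrite [leRHS]N0 probability_setC// P0 sube0.
by rewrite leNgt lte01.
Qed.

(* The scale of a centred normal law is read off its density at 0, and the
   rescaled variable [s' / s * X] has the same law as [X']; comparing second
   moments forces [s' = s]. *)
Lemma gauss_law_eq X X' : measurable_fun setT X -> measurable_fun setT X' ->
  (forall a, gauss_law (fun w => a * X w)) -> gauss_law X' ->
  ip P X X = ip P X' X' ->
  forall B : set R, measurable B -> P (X @^-1` B) = P (X' @^-1` B).
Proof.
move=> mX mX' gaX gX' XX' B mB.
have gX : gauss_law X.
  by have := gaX 1; congr gauss_law; apply/funext => w; rewrite mul1r.
case: gX => [law|[s [s0 law]]]; case: gX' => [law'|[s' [s'0 law']]].
- by rewrite law// law'.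
- by have := ip_normal mX' s'0 law'; rewrite -XX' ip_dirac// eqxx.
- by have := ip_normal mX s0 law; rewrite XX' ip_dirac// eqxx.
have sX : sqint P X by apply: gauss_law_sqint => //; right; exists s.
have X0 := ip_normal mX s0 law.
pose a := s' / s; have a0 : 0 < a by rewrite divr_gt0.
have maX : measurable_fun setT (fun w => a * X w) by exact: measurable_funM.
have ipa : ip P (fun w => a * X w) (fun w => a * X w) = a ^+ 2 * ip P X X.
  rewrite ipZl//; last exact: sqintZ.
  by rewrite ipC ipZl// mulrA expr2.
case: (gaX a) => [lawa|[t [t0 lawa]]].
  have := ip_dirac maX lawa; rewrite ipa => /eqP.
  by rewrite mulf_eq0 (negbTE X0) sqrf_eq0 gt_eqF.
have ts : t = s'.
  rewrite (_ : s' = a * s); last by rewrite /a; field; rewrite gt_eqF.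
  apply: (@normal_prob_scale R s t a) => // r r0.
  rewrite -law; last exact: measurable_itv.
  rewrite -lawa; last exact: measurable_itv.
  by congr (P _); apply/seteqP; split => w /=; rewrite !in_itv/= -mulrN !ler_pM2l.
have sq' : ip P (fun w => a * X w) (fun w => a * X w) = ip P X' X'.
  have saX : sqint P (fun w => a * X w) by exact: sqintZ.
  have sX' : sqint P X' by apply: gauss_law_sqint => //; right; exists s'.
  have m2 : measurable_fun setT (fun y : R => (y ^+ 2)%:E).
    exact/measurable_EFinP/measurable_funX.
  have p2 (y : R) : (0 <= (y ^+ 2)%:E)%E by rewrite lee_fin sqr_ge0.
  apply: EFin_inj; rewrite -!ipE//.
  rewrite (integral_law (nu := normal_prob 0 t) maX lawa m2 p2).
  by rewrite (integral_law (nu := normal_prob 0 s') mX' law' m2 p2) ts.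
have a1 : a = 1.
  move: sq'; rewrite ipa -XX' -[RHS]mul1r => /(mulIf X0) /eqP.
  by rewrite sqrf_eq1 => /orP[/eqP//|/eqP aN1]; move: a0; rewrite aN1; lra.
have ss : s' = s by rewrite -[LHS](divfK (lt0r_neq0 s0)) -/a a1 mul1r.
by rewrite law// law'// ss.
Qed.

(* [(Z, L)] and [(-Z, L)] have the same law, and the parallelogram identity
   averages the two errors. *)
Lemma gauss_lower n (L : 'I_n -> Om -> R) (Z : Om -> R) (psi : n.-tuple R -> R) :
  measurable_fun setT Z -> (forall i, measurable_fun setT (L i)) ->
  (forall c b, gauss_law (fun w => c * Z w + lc b L w)) ->
  (forall i, ip P Z (L i) = 0) -> measurable_fun setT psi ->
  (\int[P]_w (Z w ^+ 2)%:E <= \int[P]_w ((Z w + psi [tuple L i w | i < n]) ^+ 2)%:E)%E.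
Proof.
move=> mZ mL gZL ZL mpsi.
have sZ : sqint P Z.
  apply: gauss_law_sqint => //; have := gZL 1 (fun=> 0).
  congr gauss_law; apply/funext => w; rewrite /lc mul1r big1 ?addr0// => i _.
  by rewrite mul0r.
have sL i : sqint P (L i).
  apply: gauss_law_sqint => //; have := gZL 0 (fun j => (j == i)%:R).
  congr gauss_law; apply/funext => w; rewrite /lc mul0r add0r (bigD1 i)//= eqxx mul1r.
  by rewrite big1 ?addr0// => j /negbTE ->; rewrite mul0r.
pose T w := [tuple L i w | i < n].
have mT : measurable_fun setT T.
  apply/measurable_fun_tnthP => i.
  rewrite (_ : _ \o _ = L i)//; apply/funext => w /=; exact: tnth_mktuple.
pose X w : n.+1.-tuple R := [the n.+1.-tuple R of Z w :: T w].
pose X' w : n.+1.-tuple R := [the n.+1.-tuple R of (- Z w) :: T w].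
have mNZ : measurable_fun setT (fun w => - Z w) by exact: measurableT_comp.
have mX : measurable_fun setT X by exact: measurable_cons.
have mX' : measurable_fun setT X' by exact: (measurable_cons mNZ mT).
have dotE (b : 'I_n.+1 -> R) z w :
    dot b [the n.+1.-tuple R of z :: T w] = b ord0 * z + lc (fun i => b (lift ord0 i)) L w.
  rewrite /dot big_ord_recl tnth0; congr (_ + _); apply: eq_bigr => i _.
  by rewrite tnthS tnth_mktuple.
have same b (B : set R) : measurable B -> P ((dot b \o X) @^-1` B) = P ((dot b \o X') @^-1` B).
  move=> mB.
  pose l := lc (fun i => b (lift ord0 i)) L.
  have eX : dot b \o X = fun w => b ord0 * Z w + l w.
    by apply/funext => w; rewrite /= dotE.
  have eX' : dot b \o X' = fun w => (- b ord0) * Z w + l w.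
    by apply/funext => w; rewrite /= dotE mulrN mulNr.
  have sl : sqint P l by exact: sqint_lc.
  rewrite eX eX'; apply: gauss_law_eq => //.
  - by case: (sqintZD (b ord0) sZ sl).
  - by case: (sqintZD (- b ord0) sZ sl).
  - move=> a; have := gZL (a * b ord0) (fun i => a * b (lift ord0 i)).
    congr gauss_law; apply/funext => w; rewrite mulrDr mulrA; congr (_ + _).
    by rewrite /l /lc mulr_sumr; apply: eq_bigr => i _; rewrite mulrA.
  - exact: gZL.
  (* The cross term vanishes, so the variance depends on [c] only through [c ^+ 2]. *)
  - have key c : ip P (fun w => c * Z w + l w) (fun w => c * Z w + l w) = c ^+ 2 * ip P Z Z + ip P l l.
      have Zl : ip P Z l = 0 by rewrite ipC ip_lcl// big1// => i _; rewrite ipC ZL mulr0.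
      rewrite ipZDl//; last exact: sqintZD.
      rewrite [X in c * X]ipC [X in _ + X]ipC !ipZDl// (ipC P l Z) Zl mulr0 addr0 add0r.
      by rewrite mulrA -expr2.
    by rewrite !key sqrrN.
pose G (y : n.+1.-tuple R) := ((thead y + psi [tuple of behead y]) ^+ 2)%:E.
have mG : measurable_fun setT G.
  apply/measurable_EFinP; apply: measurable_funX; apply: measurable_funD.
    exact: measurable_tnth.
  by apply: (measurableT_comp mpsi); exact: measurable_behead.
have := @integral_same_law _ Om R P _ _ X X' mX mX' (cramer_wold mX mX' same) _ mG.
have bT z w : [tuple of behead [the n.+1.-tuple R of z :: T w]] = T w by apply/val_inj.
pose I := (\int[P]_w ((Z w + psi (T w)) ^+ 2)%:E)%E.
pose I' := (\int[P]_w ((- Z w + psi (T w)) ^+ 2)%:E)%E.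
have -> : (\int[P]_w G (X w) = I)%E by apply: eq_integral => w _; rewrite /G bT theadE.
have -> : (\int[P]_w G (X' w) = I')%E by apply: eq_integral => w _; rewrite /G bT theadE.
move=> II'.
have mpT : measurable_fun setT (fun w => psi (T w)) by exact: measurableT_comp.
have : (\int[P]_w (Z w ^+ 2)%:E + \int[P]_w (Z w ^+ 2)%:E <= I + I')%E.
  rewrite /I /I' -!ge0_integralD//.
  - apply: ge0_le_integral => //.
    + by move=> w _; rewrite -EFinD lee_fin addr_ge0 ?sqr_ge0.
    + by apply: emeasurable_funD; apply/measurable_EFinP/measurable_funX.
    + by apply: emeasurable_funD; apply/measurable_EFinP/measurable_funX/measurable_funD.
    + move=> w _; rewrite -!EFinD lee_fin.
      have := sqr_ge0 (psi (T w)); rewrite !expr2; lra.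
  - by move=> w _; rewrite lee_fin sqr_ge0.
  - by apply/measurable_EFinP/measurable_funX/measurable_funD.
  - by move=> w _; rewrite lee_fin sqr_ge0.
  - by apply/measurable_EFinP/measurable_funX/measurable_funD.
  - by move=> w _; rewrite lee_fin sqr_ge0.
  - by apply/measurable_EFinP/measurable_funX.
  - by move=> w _; rewrite lee_fin sqr_ge0.
  - by apply/measurable_EFinP/measurable_funX.
have I0 : (0 <= I)%E by apply: integral_ge0 => w _; rewrite lee_fin sqr_ge0.
rewrite -II' -/I ipE//; clearbody I; clear II'; case: I I0 => [r _|_ _|//].
  by rewrite -!EFinD !lee_fin; lra.
by rewrite leey.
Qed.

End gaussian_law.

(** * Measurability of the evaluation map *)

Lemma continuous_borel (R : realType) (V : normedModType R) (L : V -> R) :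
  continuous L -> measurable_fun setT (L : borel V -> R).
Proof.
move=> /continuousP cL.
apply: (measurability _ (RGenOpens.measurableE R)) => _ [_ [a [b ->]] <-].
rewrite setTI; apply: sub_sigma_algebra; apply: cL.
exact: interval_open.
Qed.

(** A Caratheodory argument: [f] is replaced by a point of the dense sequence within [1 / (k + 1)],
    selected measurably by making the balls disjoint. The approximation is measurable on each of
    countably many pieces and converges by continuity in [f]. *)
Lemma measurable_evaluation (R : realType) (V : normedModType R) (s : nat -> V)
    d (T : measurableType d) (ev : V -> T -> R) :
  dense (range s) -> (forall f, measurable_fun setT (ev f)) ->
  (forall x, continuous (ev ^~ x)) ->
  measurable_fun setT (fun p : borel V * T => ev p.1 p.2).
Proof.
move=> ds mev cev.
pose A k i : set V := ball (s i) (k.+1%:R^-1 : R).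
have oA k i : open (A k i) by exact: ball_open.
have covA k f : exists i, A k i f.
  have := ds (ball f (k.+1%:R^-1 : R)) _ (ball_open _ _).
  case=> [|y [fy [i _ iy]]].
  - by exists f; apply: ballxx; rewrite invr_gt0 ltr0n.
  - by exists i; rewrite /A iy; exact: ball_sym.
pose B k := seqDU (A k).
have covB k f : exists i, B k i f.
  have : (\bigcup_i A k i) f by have [i Ai] := covA k f; exists i.
  by rewrite seqDU_bigcup_eq => -[i _ Bi]; exists i.
pose idx k f := xget 0%N [set i | B k i f].
have idxP k f : B k (idx k f) f by exact: (@xgetPex _ 0%N [set i | B k i f] (covB k f)).
have idx_uniq k f i : B k i f -> idx k f = i.
  move=> Bi; have /trivIsetP tB := trivIset_seqDU (A k).
  apply: contrapT => /eqP ne.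
  have := tB _ _ I I ne; rewrite -subset0 => /(_ f); apply.
  by split => //; exact: idxP.
have mB k i : measurable (B k i : set (borel V)).
  have mA j : measurable (A k j : set (borel V)) by apply: sub_sigma_algebra; exact: oA.
  rewrite /B /seqDU; apply: measurableD => //.
  by apply: bigsetU_measurable => j _.
pose g k (p : borel V * T) := ev (s (idx k p.1)) p.2.
apply: (measurable_fun_cvg (h := g)) => [k|[f x] _]; last first.
  rewrite /g/=.
  have sf : (fun k => s (idx k f)) @ \oo --> f.
    apply/cvgrPdist_lt => e e0.
    near=> k.
    have [+ _] := idxP k f; rewrite /A -ball_normE/= distrC => h.
    apply: (lt_trans h); near: k; exact: near_infty_natSinv_lt (PosNum e0).
  exact: (cvg_comp _ _ sf (cev x f)).
move=> _ C mC; rewrite setTI.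
have -> : g k @^-1` C = \bigcup_i (B k i `*` (ev (s i) @^-1` C)).
  apply/seteqP; split => [[f x] /= Cfx|[f x] [i _ [/= Bi Ci]]].
    by exists (idx k f) => //; split => //=; exact: idxP.
  by rewrite /g/= (idx_uniq _ _ _ Bi).
apply: bigcupT_measurable => i; apply: measurableX; first exact: mB.
by rewrite -[X in measurable X]setTI; exact: mev.
Unshelve. all: by end_near.
Qed.

Lemma measurable_Rintegral d1 d2 (T1 : measurableType d1) (T2 : measurableType d2)
    (R : realType) (m : {sigma_finite_measure set T1 -> \bar R}) (G : T1 * T2 -> R) :
  measurable_fun setT G ->
  measurable_fun setT (fun y => \int[m]_x G (x, y)).
Proof.
move=> mG.
have mE : measurable_fun setT (EFin \o G) by exact/measurable_EFinP.
have h1 := measurable_fun_fubini_tonelli_G (m1 := m) _ (measurable_funepos mE) (funepos_ge0 _).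
have h2 := measurable_fun_fubini_tonelli_G (m1 := m) _ (measurable_funeneg mE) (funeneg_ge0 _).
have h := emeasurable_funB h1 h2.
have mfine : measurable_fun [set: \bar R] (@fine R) by [].
have := measurableT_comp mfine h.
congr measurable_fun; apply/funext => y /=; rewrite /Rintegral [in RHS]integralE.
rewrite /fubini_G; congr fine; congr (_ - _)%E; apply: eq_integral => x _.
  by rewrite !funeposE.
by rewrite !funenegE.
Qed.

Lemma measurable_Rintegral_l d1 d2 (T1 : measurableType d1) (T2 : measurableType d2)
    (R : realType) (m : {sigma_finite_measure set T2 -> \bar R}) (G : T1 * T2 -> R) :
  measurable_fun setT G ->
  measurable_fun setT (fun x => \int[m]_y G (x, y)).
Proof.
move=> mG.
have := @measurable_Rintegral _ _ T2 T1 R m (fun p => G (p.2, p.1)).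
by apply; apply: (measurableT_comp mG); exact: measurable_fun_pair.
Qed.

Definition lin_cont (R : realType) (V : normedModType R) (L : V -> R) :=
  (forall (a : R) (u v : V), L (a *: u + v) = a * L u + L v) /\ continuous L.

Lemma lin_cont0 (R : realType) (V : normedModType R) : lin_cont (fun _ : V => 0 : R).
Proof. by split=> [a u v|]; [rewrite mulr0 addr0|exact: cst_continuous]. Qed.

Lemma lin_contZD (R : realType) (V : normedModType R) (c : R) (L M : V -> R) :
  lin_cont L -> lin_cont M -> lin_cont (fun v => c * L v + M v).
Proof.
move=> [lL cL] [lM cM]; split=> [a u v|]; first by rewrite lL lM; ring.
move=> v; apply: cvgD; last exact: cM.
by apply: cvgM; [exact: cvg_cst|exact: cL].
Qed.

Lemma lin_cont_lc (R : realType) (V : normedModType R) n (b : 'I_n -> R) (L : 'I_n -> V -> R) :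
  (forall i, lin_cont (L i)) -> lin_cont (lc b L).
Proof.
elim: n b L => [|n ih] b L hL; rewrite /lc.
  by under eq_fun do rewrite big_ord0; exact: lin_cont0.
under eq_fun do rewrite big_ord_recl.
by apply: lin_contZD => //; apply: (ih (fun i => b (lift ord0 i)) (fun i => L (lift ord0 i))).
Qed.

Lemma gauss_lin_cont (R : realType) (V : normedModType R) (mu : probability (borel V) R) (L : V -> R) :
  centered_gaussian mu -> lin_cont L -> gauss_law mu L.
Proof. by move=> gmu [lL cL]; exact: gmu. Qed.

Section weight.
Context (R : realType) (d : nat) (D : set (d.-tuple R)) (rho : d.-tuple R -> R).

(* Multiplication by this weight turns L_2(D, rho dx) into L_2 of Lebesgue measure. *)
Definition sqrt_density (x : d.-tuple R) : R := if x \in D then rho x `^ 2^-1 else 0.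

Context (mD : measurable D) (mrho : measurable_fun D rho) (rho0 : forall x, D x -> 0 <= rho x).

Lemma measurable_on_D (g : d.-tuple R -> R) :
  measurable_fun D g -> measurable_fun setT (fun x => g x * sqrt_density x).
Proof.
move=> mg.
have := (measurable_restrictT (fun x => g x * rho x `^ 2^-1) mD).1.
rewrite (_ : _ \_ D = fun x => g x * sqrt_density x).
  apply; apply: measurable_funM => //.
  exact: (measurableT_comp (measurable_powR 2^-1) mrho).
by apply/funext => x; rewrite /patch /sqrt_density; case: ifP; rewrite ?mulr0.
Qed.

Lemma measurable_sqrt_density : measurable_fun setT sqrt_density.
Proof.
have m1 : measurable_fun D (fun _ : d.-tuple R => 1 : R) by exact: measurable_cst.
have := measurable_on_D m1.
by congr measurable_fun; apply/funext => x; rewrite mul1r.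
Qed.

Lemma sqrt_density_ge0 x : 0 <= sqrt_density x.
Proof. by rewrite /sqrt_density; case: ifP => // _; exact: powR_ge0. Qed.

Lemma sqrt_density_neq0 x : sqrt_density x != 0 -> D x.
Proof. by rewrite /sqrt_density; case: ifPn; rewrite ?eqxx// inE. Qed.

Lemma L2norm2E g : L2norm2 D rho g =
  (\int[@leb_tuple R d]_x ((g x * sqrt_density x) ^+ 2)%:E)%E.
Proof.
have [lam lamE] := leb_tuple_measure R d.
rewrite /L2norm2 -lamE integral_mkcond; apply: eq_integral => x _.
rewrite /patch /sqrt_density; case: ifPn => [/set_mem Dx|_]; last by rewrite mulr0 expr0n.
congr EFin; rewrite exprMn powR12_sqrt ?sqr_sqrtr//; exact: rho0.
Qed.

End weight.

(** * From arbitrary functionals to sampling *)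

Section gaussian_process.
Context d1 (Om : measurableType d1) (R : realType) (P : probability Om R).
Context d2 (T : measurableType d2) (lam : {sigma_finite_measure set T -> \bar R}).
Context n (X : Om -> T -> R) (L : 'I_n -> Om -> R) (phi : n.-tuple R -> T -> R).
Context (mX : measurable_fun setT (fun p : Om * T => X p.1 p.2)).
Context (mL : forall i, measurable_fun setT (L i)).
Context (mphi : measurable_fun setT (fun p : n.-tuple R * T => phi p.1 p.2)).
Context (sX : forall w, sqint lam (X w)).
Context (gL : forall i, gauss_law P (L i)).
Context (gXL : forall x c b, gauss_law P (fun w => c * X w x + lc b L w)).

(** The clauses on zeros serve the return from weighted functions: a sampling point where some path
    is nonzero lies in the domain, and a [g i] that vanishes where all paths do survives division by
    the weight. *)
Lemma gaussian_sampling (C : R) : 0 <= C ->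
  (\int[P]_w \int[lam]_x ((X w x - phi [tuple L i w | i < n] x) ^+ 2)%:E <= C%:E)%E ->
  exists k (z : 'I_k -> T) (g : 'I_k -> T -> R),
  [/\ (k <= n)%N, forall i, exists w, X w (z i) != 0, forall i, sqint lam (g i),
      forall i x, (forall w, X w x = 0) -> g i x = 0 &
      (\int[P]_w \int[lam]_x ((X w x - \sum_i X w (z i) * g i x) ^+ 2)%:E
        <= (k.+1%:R * C)%:E)%E].
Proof.
move=> C0 errC.
have mXx x : measurable_fun setT (X ^~ x).
  exact: (measurableT_comp mX (measurable_pair2 x)).
have sXx x : sqint P (X ^~ x).
  apply: gauss_law_sqint => //; have := gXL x 1 (fun=> 0).
  congr gauss_law; apply/funext => w; rewrite /lc mul1r big1 ?addr0// => i _.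
  by rewrite mul0r.
have sL i : sqint P (L i).
  exact: gauss_law_sqint.
pose S1 : set (Om -> R) := [set f | exists a, f = lc a L].
have [|||//|kY [Y [kYn onY S1Y resY]]] := @orthonormal_basis _ Om R P n L S1.
- by move=> f [a ->]; exact: sqint_lc.
- by exists (fun=> 0); apply/funext => w; rewrite /lc big1// => i _; rewrite mul0r.
- move=> a f g [b ->] [b' ->]; exists (fun i => a * b i + b' i).
  apply/funext => w; rewrite /lc mulr_sumr -big_split; apply: eq_bigr => i _ /=; ring.
have [sY oneY] := onY.
have [M YM] := choice S1Y.
pose c j x := ip P (X ^~ x) (Y j).
pose Z x := res P Y (X ^~ x).
have sZ x : sqint P (Z x) by exact: sqint_res.
have ZL x i : ip P (Z x) (L i) = 0.
  have sr := sqint_res onY (sL i).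
  have sl := sqint_lc (fun j => ip P (L i) (Y j)) sY.
  rewrite ipC; transitivity (ip P (res P Y (L i)) (Z x) + ip P (lc (fun j => ip P (L i) (Y j)) Y) (Z x)).
    rewrite -ipDl//; congr ip; apply/funext => w; by rewrite /res subrK.
  (* [L i] equals its expansion in [Y] only up to norm zero, which suffices for inner products. *)
  rewrite (ip_eq0 sr (sZ x)); last by apply: resY; exists (fun j => (j == i)%:R);
    apply/funext => w; rewrite /lc (bigD1 i)//= eqxx mul1r big1 ?addr0// => j /negbTE ->; rewrite mul0r.
  rewrite add0r ip_lcl// big1// => j _.
  by rewrite [X in _ * X]ipC res_orth ?mulr0.
have mY j : measurable_fun setT (Y j) by case: (sY j).
have mc j : measurable_fun setT (c j).
  apply: (@measurable_Rintegral _ _ Om T R P (fun p => X p.1 p.2 * Y j p.1)).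
  by apply: measurable_funM => //; exact: (measurableT_comp (mY j)).
have mZ : measurable_fun setT (fun p : Om * T => Z p.2 p.1).
  apply: measurable_funB => //; apply: measurable_sum => j.
  apply: measurable_funM; first exact: (measurableT_comp (mc j)).
  exact: (measurableT_comp (mY j)).
(* Regression minus the given algorithm: its error at [x] is [Z x] plus this function of the data,
   the form that [gauss_lower] asks for. *)
pose psi x (y : n.-tuple R) := \sum_j c j x * (\sum_i M j i * tnth y i) - phi y x.
have ZE x w : Z x w + psi x [tuple L i w | i < n] = X w x - phi [tuple L i w | i < n] x.
  rewrite /Z /res /psi; have -> : lc (fun j => ip P (X^~ x) (Y j)) Y w =
      \sum_j c j x * (\sum_i M j i * tnth [tuple L i0 w | i0 < n] i).
    apply: eq_bigr => j _; congr (_ * _); rewrite YM; apply: eq_bigr => i _.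
    by rewrite tnth_mktuple.
  by rewrite addrA subrK.
have mT : measurable_fun setT (fun w => [tuple L i w | i < n]).
  apply/measurable_fun_tnthP => i.
  by rewrite (_ : _ \o _ = L i)//; apply/funext => w /=; exact: tnth_mktuple.
have low x : (\int[P]_w (Z x w ^+ 2)%:E <=
    \int[P]_w ((X w x - phi [tuple L i w | i < n] x) ^+ 2)%:E)%E.
  under [leRHS]eq_integral do rewrite -ZE.
  apply: gauss_lower => //.
  - by case: (sZ x).
  - move=> a b.
    have [b' b'E] := @lc_comp _ Om R _ _ L Y (fun j => c j x) S1Y.
    have := gXL x a (fun i => b i - a * b' i).
    congr gauss_law; apply/funext => w; rewrite /Z /res.
    have -> : lc (fun j => ip P (X^~ x) (Y j)) Y w = lc b' L w by rewrite -b'E.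
    rewrite mulrBr -addrA; congr (_ + _).
    rewrite /lc mulr_sumr -sumrN -big_split; apply: eq_bigr => i _ /=; ring.
  - apply: measurable_funB; last exact: (measurableT_comp mphi (measurable_pair2 x)).
    apply: measurable_sum => j; apply: measurable_funM => //.
    apply: measurable_sum => i; apply: measurable_funM => //; exact: measurable_tnth.
have mZ2 : measurable_fun setT (fun p : Om * T => (Z p.2 p.1 ^+ 2)%:E).
  exact/measurable_EFinP/measurable_funX.
have Z20 (p : Om * T) : (0 <= (Z p.2 p.1 ^+ 2)%:E)%E by rewrite lee_fin sqr_ge0.
have mE2 : measurable_fun setT (fun p : Om * T =>
    ((X p.1 p.2 - phi [tuple L i p.1 | i < n] p.2) ^+ 2)%:E).
  apply/measurable_EFinP; apply: measurable_funX; apply: measurable_funB => //.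
  have mp : measurable_fun setT (fun p : Om * T => ([tuple L i p.1 | i < n], p.2)).
    by apply: measurable_fun_pair => //; exact: (measurableT_comp mT).
  exact: (measurableT_comp mphi mp).
have E20 (p : Om * T) : (0 <= ((X p.1 p.2 - phi [tuple L i p.1 | i < n] p.2) ^+ 2)%:E)%E.
  by rewrite lee_fin sqr_ge0.
have ZC : (\int[P]_w \int[lam]_x (Z x w ^+ 2)%:E <= C%:E)%E.
  rewrite (fubini_tonelli (m1 := P) (m2 := lam) _ mZ2 Z20).
  apply: le_trans errC.
  rewrite (fubini_tonelli (m1 := P) (m2 := lam) _ mE2 E20).
  apply: ge0_le_integral => //.
  - by move=> x _; apply: integral_ge0 => w _; rewrite lee_fin sqr_ge0.
  - exact: (measurable_fun_fubini_tonelli_G (m1 := P) _ mZ2 Z20).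
  - exact: (measurable_fun_fubini_tonelli_G (m1 := P) _ mE2 E20).
  - by move=> x _; exact: low.
pose S2 : set (T -> R) := [set g | sqint lam g /\ exists a, g = lc a c].
have [||||k [eta [kkY on2 S2e res2]]] := @orthonormal_basis _ T R lam kY c S2.
- by move=> f [].
- split; first exact: sqint0.
  by exists (fun=> 0); apply/funext => x; rewrite /lc big1// => i _; rewrite mul0r.
- move=> a f g [sf [b fb]] [sg [b' gb']]; split; first exact: sqintZD.
  exists (fun i => a * b i + b' i); rewrite fb gb'.
  apply/funext => x; rewrite /lc mulr_sumr -big_split; apply: eq_bigr => i _ /=; ring.
- by move=> f [].
have [seta one2] := on2.
pose Q w := res lam eta (X w).
have sQ w : sqint lam (Q w) by exact: sqint_res.
(* Path by path, [X w - Z w] is a combination of the [c j] with coefficients [Y j w]. Either the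
   residual path has infinite norm, or this combination is square-integrable and within norm zero of
   the span of [eta]; the best approximation from that span then has no larger error. *)
have Qle w : (\int[lam]_x (Q w x ^+ 2)%:E <= \int[lam]_x (Z x w ^+ 2)%:E)%E.
  have [Zy|] := ltP (\int[lam]_x (Z x w ^+ 2)%:E)%E +oo%E; last first.
    by rewrite leye_eq => /eqP ->; rewrite leey.
  have sZw : sqint lam (fun x => Z x w).
    by apply: sqintP => //; exact: (measurableT_comp mZ (measurable_pair1 w)).
  pose v := lc (fun j => Y j w) c.
  have vE : v = fun x => X w x - Z x w.
    apply/funext => x; rewrite /Z /res opprB addrCA subrr addr0.
    by apply: eq_bigr => j _; rewrite mulrC.
  have sv : sqint lam v by rewrite vE; exact: sqintB.
  have r0 : ip lam (res lam eta v) (res lam eta v) = 0.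
    by apply: res2; split => //; eexists.
  have sr : sqint lam (res lam eta v) by exact: sqint_res.
  rewrite !ipE// lee_fin.
  apply: (le_trans (res_min (fun j => ip lam v (eta j)) on2 (sX w))).
  have -> : (fun x => X w x - lc (fun j => ip lam v (eta j)) eta x) =
      (fun x => Z x w + res lam eta v x).
    apply/funext => x; have vx : v x = X w x - Z x w by rewrite vE.
    by rewrite /res vx; ring.
  have sZr := sqintD sZw sr.
  rewrite ipDl// (ip_eq0 sr sZr r0) addr0 ipC ipDl//.
  by rewrite (ip_eq0 sr sZw r0) addr0.
have mQ : measurable_fun setT (fun p : Om * T => Q p.1 p.2).
  apply: measurable_funB => //; apply: measurable_sum => j.
  have me : measurable_fun setT (eta j) by case: (seta j).
  apply: measurable_funM; last exact: (measurableT_comp me).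
  have mi : measurable_fun setT (fun w => ip lam (X w) (eta j)).
    apply: (@measurable_Rintegral_l _ _ Om T R lam (fun p => X p.1 p.2 * eta j p.2)).
    by apply: measurable_funM => //; exact: (measurableT_comp me).
  exact: (measurableT_comp mi).
have mQ2 : measurable_fun setT (fun p : Om * T => (Q p.1 p.2 ^+ 2)%:E).
  exact/measurable_EFinP/measurable_funX.
have Q20 (p : Om * T) : (0 <= (Q p.1 p.2 ^+ 2)%:E)%E by rewrite lee_fin sqr_ge0.
have QC : (\int[P]_w \int[lam]_x (Q w x ^+ 2)%:E <= C%:E)%E.
  apply: le_trans ZC; apply: ge0_le_integral => //.
  - by move=> w _; apply: integral_ge0 => x _; rewrite lee_fin sqr_ge0.
  - exact: (measurable_fun_fubini_tonelli_F (m2 := lam) _ mQ2 Q20).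
  - exact: (measurable_fun_fubini_tonelli_F (m2 := lam) _ mZ2 Z20).
have [z [g [nz ge rep errg]]] := @interpolation _ _ Om T R P lam k eta Q C on2 C0
  mQ sQ (fun w j => res_orth j on2 (sX w)) QC.
have eta0 x : (forall w, X w x = 0) -> forall j, eta j x = 0.
  move=> X0 j; have [_ [a ->]] := S2e j; rewrite /lc big1// => i _.
  rewrite /c (_ : X^~ x = fun=> 0) ?ip0l ?mulr0//; exact/funext.
exists k, z, g; split.
- exact: leq_trans kkY kYn.
- move=> i; have [j /eqP nzj] := nz i; apply: contrapT => /forallNP X0; apply: nzj.
  by apply: eta0 => w; apply/eqP; have /negP := X0 w; rewrite negbK.
- by move=> i; have [a ->] := ge i; exact: sqint_lc.
- by move=> i x X0; have [a ->] := ge i; rewrite /lc big1// => j _; rewrite eta0// mulr0.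
- apply: le_trans errg; rewrite le_eqVlt; apply/orP; left; apply/eqP.
  apply: eq_integral => w _; apply: eq_integral => x _; congr EFin; congr (_ ^+ 2).
  (* [u] is the projection of the path on the span of [eta], which interpolation reproduces exactly;
     so interpolating [X w] or [Q w] leaves the same error. *)
  pose u := lc (fun j => ip lam (X w) (eta j)) eta.
  have QE y : Q w y = X w y - u y by [].
  rewrite QE; have -> : u x = \sum_i u (z i) * g i x by rewrite /u rep.
  rewrite -addrA -opprD -big_split/=; congr (_ - _); apply: eq_bigr => i _.
  by rewrite QE; ring.
Qed.

End gaussian_process.

(** Everything is multiplied by [sqrt_density], which replaces the weighted norm on [D] by that of
    Lebesgue measure on the whole space; the resulting algorithm is divided by it again. *)
Lemma std_of_all (R : realType) (d : nat) (D : set (d.-tuple R))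
  (rho : d.-tuple R -> R) (F : completeNormedModType R)
  (ev : F -> d.-tuple R -> R) (mu : probability (borel F) R)
  n (L : 'I_n -> F -> R) (phi : n.-tuple R -> d.-tuple R -> R) (C : R) :
  avg_setting D rho ev mu -> admissible D ev Lall L -> admissible_phi D rho phi -> 0 <= C ->
  (\int[mu]_f L2norm2 D rho (fun x => (ev f x - phi [tuple L i f | i < n] x)%R) <= C%:E)%E ->
  exists (L' : 'I_n -> F -> R) (phi' : n.-tuple R -> d.-tuple R -> R),
    [/\ admissible D ev Lstd L', admissible_phi D rho phi' &
    (\int[mu]_f L2norm2 D rho (fun x => (ev f x - phi' [tuple L' i f | i < n] x)%R)
      <= (n.+1%:R * C)%:E)%E].
Proof.
move=> [[mD D0] [mrho rho0 _] [[s ds] evlin _] [mev _ [c0 evc]] [evcont gmu]] admL [mphi _] C0 errC.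
have [lam lamE] := leb_tuple_measure R d.
have [x0 Dx0] : exists x, D x.
  apply: contrapT => /forallNP nD; have D_0 : D = set0 by apply/seteqP; split => x // /nD.
  by move: D0; rewrite D_0 -lamE measure0 ltxx.
pose w := sqrt_density D rho.
have L2E g : L2norm2 D rho g = (\int[lam]_x ((g x * w x) ^+ 2)%:E)%E.
  by rewrite (L2norm2E rho0) -lamE.
pose X (f : borel F) x := ev f x * w x.
have Xlin x : lin_cont (X ^~ x : F -> R).
  have [wx0|wx0] := eqVneq (w x) 0.
    by rewrite /X wx0; under eq_fun do rewrite mulr0; exact: lin_cont0.
  have Dx := sqrt_density_neq0 wx0; split=> [a u v|].
    by rewrite /X evlin//; ring.
  by move=> f; apply: cvgM; [exact: evcont|exact: cvg_cst].
have Llin i : lin_cont (L i) by exact: admL.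
have mX : measurable_fun setT (fun p : borel F * d.-tuple R => X p.1 p.2).
  apply: (@measurable_evaluation R F s _ _ X ds) => [f|x].
    by apply: measurable_on_D => //; exact: mev.
  by case: (Xlin x).
have mw : measurable_fun setT w by exact: measurable_sqrt_density.
have sX f : sqint lam (X f).
  apply: sqintP; first by apply: measurable_on_D => //; exact: mev.
  by rewrite -L2E; apply: le_lt_trans (evc f) _; rewrite ltry.
have errC' : (\int[mu]_f \int[lam]_x
    ((X f x - phi [tuple L i f | i < n] x * w x) ^+ 2)%:E <= C%:E)%E.
  apply: le_trans errC; rewrite le_eqVlt; apply/orP; left; apply/eqP.
  by apply: eq_integral => f _; rewrite L2E; apply: eq_integral => x _; rewrite /X mulrBl.
have [k [z [g [kn znz sg g0 errg]]]] := @gaussian_sampling _ (borel F) R mu _ _ lam n X L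
  (fun y x => phi y x * w x) mX (fun i => continuous_borel (Llin i).2)
  (measurable_funM mphi (measurableT_comp mw measurable_snd)) sX
  (fun i => gauss_lin_cont gmu (Llin i))
  (fun x c b => gauss_lin_cont gmu (lin_contZD c (Xlin x) (lin_cont_lc b Llin))) C C0 errC'.
have Dz i : D (z i).
  have [f] := znz i; rewrite /X mulf_eq0 negb_or => /andP[_]; exact: sqrt_density_neq0.
(* There may be fewer than [n] sampling points; the list is padded with [x0], and [phi'] ignores the
   extra values. *)
pose x' (i : 'I_n) := if insub (val i) is Some j then z j else x0.
have x'E j : x' (widen_ord kn j) = z j by rewrite /x' /= valK.
(* The factor [w (z j)] turns a sample of [ev f] into one of [X f]. Where [w x = 0] the quotient is
   0 by convention, in agreement with [gw]. *)
pose phi' (y : n.-tuple R) x := (\sum_j tnth y (widen_ord kn j) * (w (z j) * g j x)) / w x.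
have gw j x : w x = 0 -> g j x = 0.
  by move=> wx0; apply: g0 => f; rewrite /X wx0 mulr0.
have phi'w y x : phi' y x * w x = \sum_j tnth y (widen_ord kn j) * (w (z j) * g j x).
  have [wx0|wx0] := eqVneq (w x) 0; last by rewrite /phi' divfK.
  by rewrite wx0 mulr0 big1// => j _; rewrite gw// !mulr0.
exists (fun i f => ev f (x' i)), phi'; split.
- exists x' => i; split => //; rewrite /x'; case: insubP => //.
- split=> [|y]; last first.
    rewrite L2E; have sl := sqint_lc (fun j => tnth y (widen_ord kn j) * w (z j)) sg.
    rewrite (_ : (\int[_]_x _)%E = \int[lam]_x
      (lc (fun j => tnth y (widen_ord kn j) * w (z j)) g x ^+ 2)%:E)%E.
      by rewrite ipE// ltry.
    apply: eq_integral => x _; rewrite phi'w /lc; congr (EFin (_ ^+ 2)).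
    by apply: eq_bigr => j _; rewrite mulrA.
  apply: measurable_funM.
    apply: measurable_sum => j; apply: measurable_funM.
      exact: (measurableT_comp (measurable_tnth _) measurable_fst).
    apply: measurable_funM => //.
    by apply: (measurableT_comp _ measurable_snd); case: (sg j).
  have mV : measurable_fun setT (fun x => (w x)^-1).
    have := measurableT_comp (measurable_powR (-1)) mw.
    congr measurable_fun; apply/funext => x /=; rewrite powR_inv1//.
    exact: sqrt_density_ge0.
  exact: (measurableT_comp mV measurable_snd).
- have h : ((k.+1%:R * C)%:E <= (n.+1%:R * C)%:E)%E.
    by rewrite lee_fin ler_wpM2r// ler_nat.
  apply: le_trans h; apply: le_trans errg; rewrite le_eqVlt; apply/orP; left; apply/eqP.
  apply: eq_integral => f _; rewrite L2E; apply: eq_integral => x _.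
  congr (EFin (_ ^+ 2)); rewrite mulrBl phi'w; congr (_ - _); apply: eq_bigr => j _.
  by rewrite tnth_mktuple x'E /X mulrA.
Qed.

(** * Information complexity *)

Lemma L2norm2_ge0 (R : realType) (d : nat) (D : set (d.-tuple R)) (rho : d.-tuple R -> R) g :
  (forall x, D x -> 0 <= rho x) -> (0 <= L2norm2 D rho g)%E.
Proof.
move=> rho0; rewrite /L2norm2; have [lam <-] := leb_tuple_measure R d.
by apply: integral_ge0 => x Dx; rewrite lee_fin mulr_ge0 ?sqr_ge0 ?rho0.
Qed.

Lemma poweR_half_le (R : realType) (x : \bar R) (e : R) : (0 <= x)%E -> 0 <= e ->
  (x `^ (2^-1 : R) <= e%:E)%E = (x <= (e ^+ 2)%:E)%E.
Proof.
move=> x0 e0; case: x x0 => [r r0|_|//]; last first.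
  by rewrite poweRyr ?invr_eq0// !leye_eq.
rewrite poweR_EFin !lee_fin powR12_sqrt// -(ler_sqr _ e0) ?nnegrE ?sqrtr_ge0//.
by rewrite sqr_sqrtr.
Qed.

Section complexity.
Context (R : realType) (d : nat) (D : set (d.-tuple R)) (rho : d.-tuple R -> R).
Context (F : completeNormedModType R) (ev : F -> d.-tuple R -> R).
Context (mu : probability (borel F) R).

Lemma nABS_le Lam eps n : (nth_min_err D rho ev mu Lam n <= eps%:E)%E ->
  (nABS D rho ev mu Lam eps <= n%:R%:E)%E.
Proof. by move=> h; apply: ereal_inf_lbound; exists n. Qed.

Lemma nABS_attained Lam eps : (nABS D rho ev mu Lam eps < +oo)%E ->
  exists2 n, (nth_min_err D rho ev mu Lam n <= eps%:E)%E &
    nABS D rho ev mu Lam eps = n%:R%:E.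
Proof.
move=> fin.
have exn : exists n, (nth_min_err D rho ev mu Lam n <= eps%:E)%E.
  by have [_ [n hn _] _] := ereal_inf_lt fin; exists n.
case: (ex_minnP exn) => n hn nmin; exists n => //.
apply/eqP; rewrite eq_le nABS_le//=.
by apply: le_ereal_inf_tmp => _ [m hm <-]; rewrite lee_fin ler_nat; exact: nmin.
Qed.

Context (setting : avg_setting D rho ev mu).

Lemma all_le_std n :
  (nth_min_err D rho ev mu Lall n <= nth_min_err D rho ev mu Lstd n)%E.
Proof.
case: n => [//|n]; apply: le_ereal_inf => _ [L [phi [[x hx] aphi ->]]].
exists L, phi; split => //.
case: setting => _ _ [_ evlin _] _ [evc _] i; have [Dx ->] := hx i.
by split; [move=> a u v; exact: evlin|exact: evc].
Qed.

Lemma nABS_all_le_std eps :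
  (nABS D rho ev mu Lall eps <= nABS D rho ev mu Lstd eps)%E.
Proof.
apply: le_ereal_inf => _ [n hn <-]; exists n => //.
exact: le_trans (all_le_std n) hn.
Qed.

(** The infimum need not be attained, so an algorithm with error below [2 * e] is picked; hence the
    factor 2. For [n = 0] both classes use the zero algorithm. *)
Lemma std_err_le_of_all n e eps : 0 < e -> e <= eps ->
  n.+1%:R * (2 * e) ^+ 2 <= eps ^+ 2 ->
  (nth_min_err D rho ev mu Lall n <= e%:E)%E ->
  (nth_min_err D rho ev mu Lstd n <= eps%:E)%E.
Proof.
move=> e0 eeps neps.
have eps0 : 0 <= eps by apply: le_trans eeps; exact: ltW.
have rho0 : forall x, D x -> 0 <= rho x by case: setting => _ [].
case: n neps => [|n] neps h.
  by apply: le_trans h _; rewrite lee_fin.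
have lt2e : (nth_min_err D rho ev mu Lall n.+1 < (2 * e)%:E)%E.
  by apply: le_lt_trans h _; rewrite lte_fin; lra.
have [_ [L [phi [aL aphi ->]]] err] := ereal_inf_lt lt2e.
have I0 n' (L' : 'I_n' -> F -> R) phi' :
    (0 <= \int[mu]_f L2norm2 D rho (fun x => (ev f x - phi' [tuple L' i f | i < n'] x)%R))%E.
  by apply: integral_ge0 => f _; exact: L2norm2_ge0.
have e20 : 0 <= 2 * e by lra.
have := ltW err; rewrite /avg_err poweR_half_le// => errC.
have [L' [phi' [aL' aphi' errC']]] := std_of_all setting aL aphi (sqr_ge0 _) errC.
apply: ge_ereal_inf; exists (avg_err D rho ev mu L' phi'); first by exists L', phi'.
rewrite /avg_err poweR_half_le//; apply: le_trans errC' _.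
by rewrite lee_fin.
Qed.

End complexity.

Lemma ln_nat_le (R : realType) (m n : nat) : (m <= n)%N -> ln (m%:R : R) <= ln n%:R.
Proof.
case: m => [_|m mn].
  rewrite ln0//; case: n => [|n]; first by rewrite ln0.
  by rewrite ln_ge0// ler1n.
by rewrite ler_ln ?qualifE/= ?ltr0n ?ler_nat// (leq_trans _ mn).
Qed.

(** Brings the cost at the finer accuracy back to that at [eps], with [t = 1 + ln eps^-1] and [s]
    the power of [d]. The sum is at most twice the larger of [5 * t] and [s]; if that is [s], the
    exponent is raised to 1. *)
Lemma powR_affine_le (R : realType) (t s a : R) : 1 <= t -> 1 <= s -> 0 < a -> a <= 1 ->
  (5 * t + s) `^ a <= 10 * t `^ a + 2 * s.
Proof.
move=> t1 s1 a0 a1.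
have p2 (c y : R) : 1 <= c -> 0 <= y -> (c * y) `^ a <= c * y `^ a.
  move=> c1 y0; rewrite powRM//; last by lra.
  by rewrite ler_wpM2r ?powR_ge0// -[leRHS]powRr1; [rewrite ler_powR|lra].
have [h|h] := leP (5 * t) s.
  apply: (@le_trans _ _ ((2 * s) `^ a)).
    by apply: ge0_ler_powR; rewrite ?nnegrE; lra.
  apply: (@le_trans _ _ ((2 * s) `^ 1)); first by rewrite ler_powR; lra.
  rewrite powRr1; last by lra.
  by have := powR_ge0 t a; lra.
apply: (@le_trans _ _ ((10 * t) `^ a)).
  by apply: ge0_ler_powR; rewrite ?nnegrE; lra.
by have := p2 10 t; have := powR_ge0 t a; lra.
Qed.

Theorem theorem5p6 (R : realType) (D : forall d : nat, set (d.-tuple R))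
  (rho : forall d : nat, d.-tuple R -> R) (F : nat -> completeNormedModType R)
  (ev : forall d : nat, F d -> d.-tuple R -> R)
  (mu : forall d : nat, probability (borel (F d)) R) :
  (forall d : nat, (0 < d)%N -> avg_setting (D d) (rho d) (ev d) (mu d)) ->
  (EXP_UWT D rho ev mu Lall <-> EXP_UWT D rho ev mu Lstd).
Proof.
move=> setting; split => H alpha beta alpha0 beta0 eta eta0; last first.
  have [M HM] := H alpha beta alpha0 beta0 eta eta0; exists M => d eps d0 eps01 Md.
  have [fin lt] := HM d eps d0 eps01 Md.
  have le_as := nABS_all_le_std (setting d d0) eps.
  have fin' := le_lt_trans le_as fin; split => //; apply: le_lt_trans lt.
  have [n _ nE] := nABS_attained fin; have [m _ mE] := nABS_attained fin'.
  move: le_as; rewrite nE mE/= lee_fin ler_nat => mn.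
  rewrite ler_wpM2r ?ln_nat_le// invr_ge0 addr_ge0 ?powR_ge0//.
(* With an exponent at most 1, the bound on [ln n] is affine in [ln eps^-1] and the power of [d];
   being at most [alpha], it also gives a smaller power of [1 + ln eps^-1]. *)
pose a := Num.min alpha 1.
have a0 : 0 < a by rewrite lt_min alpha0 ltr01.
have a1 : a <= 1 by rewrite ge_min lexx orbT.
have aalpha : a <= alpha by rewrite ge_min lexx.
(* The bound 1 yields [n <= expR (5 + 2 l + 2 s)]; the bound [eta / 10] pays for the factor 10 of
   [powR_affine_le]. *)
pose eta' := Num.min 1 (eta / 10).
have eta'0 : 0 < eta' by rewrite lt_min ltr01 divr_gt0.
have eta'1 : eta' <= 1 by rewrite ge_min lexx.
have eta'e : eta' <= eta / 10 by rewrite ge_min lexx orbT.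
have [M HM] := H a beta a0 beta0 eta' eta'0; exists M => d eps d0 /andP[eps0 eps1] Md.
pose l := ln eps^-1; pose s := d%:R `^ beta.
have l0 : 0 <= l by rewrite /l ln_ge0// invf_ge1// ltW.
have s1 : 1 <= s by rewrite -(powRr0 d%:R) /s ler_powR ?ler1n// ltW.
have epsE : eps = expR (- l) by rewrite expRN /l lnK ?invrK// qualifE/= invr_gt0.
(* With [e := eps ^+ 2 * expR (- s - 4)], the bound on [n = nABS _ e] at exponents
   [a <= 1] and [beta] gives [n.+1%:R * (2 * e) ^+ 2 <= eps ^+ 2]. *)
pose e := expR (- (2 * l + s + 4)).
have e0 : 0 < e by exact: expR_gt0.
have eeps : e <= eps by rewrite epsE ler_expR; lra.
have e1 : e < 1 by apply: le_lt_trans eps1.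
have Me : M < e^-1 + d%:R.
  by apply: lt_le_trans Md _; rewrite lerD2r lef_pV2// qualifE.
have [] := HM d e d0 _ Me; first by rewrite e0.
move=> /nABS_attained[n nerr ->] /=.
have lneE : ln e^-1 = 2 * l + s + 4 by rewrite /e expRN invrK expRK.
rewrite lneE -/s.
have tpos : 0 < (1 + (2 * l + s + 4)) `^ a + s.
  by rewrite ltr_wpDl ?powR_ge0//; lra.
rewrite ltr_pdivrMr// => lnn.
have ta : (1 + (2 * l + s + 4)) `^ a <= 1 + (2 * l + s + 4).
  have t1 : 1 <= 1 + (2 * l + s + 4) by lra.
  by apply: le_trans (ler_powR t1 a1) _; rewrite powRr1//; lra.
have nle : n%:R <= expR (1 + (2 * l + s + 4) + s).
  case: n lnn {nerr} => [_|n lnn]; first exact: expR_ge0.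
  rewrite -[leLHS]lnK ?qualifE/= ?ltr0n// ler_expR; apply: (le_trans (ltW lnn)).
  by apply: le_trans (ler_wpM2r (ltW tpos) eta'1) _; rewrite mul1r; lra.
have neps : n.+1%:R * (2 * e) ^+ 2 <= eps ^+ 2.
  have n1 : n.+1%:R <= 2 * expR (1 + (2 * l + s + 4) + s).
    rewrite -natr1; have : 1 <= expR (1 + (2 * l + s + 4) + s).
      by apply: le_trans (expR_ge1Dx _); lra.
    by move: nle; lra.
  apply: (le_trans (ler_wpM2r (sqr_ge0 _) n1)).
  have -> : 2 * expR (1 + (2 * l + s + 4) + s) * (2 * e) ^+ 2 =
      8 * (expR (1 + (2 * l + s + 4) + s) * (e * e)) by ring.
  rewrite /e -!expRD epsE expr2 -expRD.
  (* The exponents leave [-3 - 2 l], and [expR 3 >= 8] absorbs the constant 8; the 4 in [e] is there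
     for this. *)
  have -> : 1 + (2 * l + s + 4) + s + (- (2 * l + s + 4) - (2 * l + s + 4)) =
     - (1 + (1 + 1)) + (- l - l) by ring.
  rewrite (expRD (- (1 + (1 + 1)))) mulrA ler_piMl ?expR_ge0//.
  rewrite expRN ler_pdivrMr ?expR_gt0// mul1r (expRD 1 (1 + 1)) (expRD 1 1).
  have e2 : 2 <= expR 1 :> R by have := expR_ge1Dx (1 : R); lra.
  have e4 : 4 <= expR 1 * expR 1 :> R by nra.
  nra.
have std := std_err_le_of_all (setting d d0) e0 eeps neps nerr.
have le_n := nABS_le std.
have fin := le_lt_trans le_n (ltry _); split => //.
have [m _ mE] := nABS_attained fin; rewrite mE/=.
move: le_n; rewrite mE lee_fin ler_nat => mn.
have Tpos : 0 < (1 + ln eps^-1) `^ alpha + d%:R `^ beta.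
  by rewrite -/s ltr_wpDl ?powR_ge0//; lra.
rewrite ltr_pdivrMr//; apply: le_lt_trans (ln_nat_le _ mn) _.
apply: (lt_le_trans lnn); rewrite -/l -/s.
have h1 : (1 + l) `^ a <= (1 + l) `^ alpha by rewrite ler_powR//; lra.
have h2 := @powR_affine_le R (1 + l) s a _ s1 a0 a1.
have h3 : (1 + (2 * l + s + 4)) `^ a <= (5 * (1 + l) + s) `^ a.
  by apply: ge0_ler_powR; rewrite ?nnegrE; lra.
have h4 : (1 + (2 * l + s + 4)) `^ a + s <= 10 * ((1 + l) `^ alpha + s).
  have := h2 _; rewrite lerDl => /(_ l0); lra.
apply: (le_trans (ler_wpM2l (ltW eta'0) h4)).
have -> : eta * ((1 + l) `^ alpha + s) = eta / 10 * (10 * ((1 + l) `^ alpha + s)) by field.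
by apply: ler_wpM2r => //; rewrite mulr_ge0// addr_ge0 ?powR_ge0//; lra.
Qed.
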